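(* Let $X$ and $Y$ be infinite Tychonoff spaces. Then the following conditions are equivalent: (1) $C_p(X,C_p(Y))$ has the Josefson--Nissenzweig property (JNP); (2) $C_p(X,C_p(Y))$ contains a complemented copy of $(c_0)_p$; (3) $C_p(X,C_p(Y))$ admits a continuous linear surjection onto $(c_0)_p$; (4) $C_p(X)$ contains a complemented copy of $(c_0)_p$ or $C_p(Y)$ contains a complemented copy of $(c_0)_p$; (5) $C_p(X)$ admits a continuous linear surjection onto $(c_0)_p$ or $C_p(Y)$ admits a continuous linear surjection onto $(c_0)_p$; (6) $C_p(X)$ has the JNP or $C_p(Y)$ has the JNP.
   Context: For a topological space $X$ and a locally convex space $E$ over $\mathbb{R}$, $C_p(X,E)$ is the space of all continuous functions $X\to E$ with the pointwise topology (inherited from the product $E^X$); $C_p(X)=C_p(X,\mathbb{R})$. Tychonoff means completely regular and Hausdorff. $(c_0)_p=\{x\in\mathbb{R}^\omega: x(n)\to 0\}$ with the topology inherited from the product $\mathbb{R}^\omega$. A locally convex space $E$ contains a complemented copy of $F$ if there are closed linear subspaces $E_1,E_2$ of $E$ with $E=E_1\oplus E_2$ algebraically, $E_1$ linearly homeomorphic to $F$, and the natural projection of $E$ onto $E_1$ continuous. A barrel in $E$ is a closed, absolutely convex, absorbing set; a subset of $E$ is barrel-bounded if it is absorbed by every barrel in $E$. $\beta^*(E',E)$ is the topology on the topological dual $E'$ of uniform convergence on barrel-bounded subsets of $E$. $E$ has the Josefson--Nissenzweig property (JNP) if the identity map $(E',\sigma(E',E))\to(E',\beta^*(E',E))$ is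 not sequentially continuous, i.e. there is a weak$^*$ null sequence in $E'$ that does not converge to $0$ in $\beta^*(E',E)$. *)

(* Defs.v *)
From HB Require Import structures.
From mathcomp Require Import all_boot all_order all_algebra.
From mathcomp Require Import all_classical all_reals all_analysis.

Set Implicit Arguments.
Unset Strict Implicit.
Unset Printing Implicit Defensive.

Import Order.TTheory GRing.Theory Num.Theory.
Import numFieldNormedType.Exports.

Local Open Scope classical_set_scope.
Local Open Scope ring_scope.

Section tychonoff_space.
Context {X : topologicalType}.

Definition tychonoff_space := completely_regular_space X /\ hausdorff_space X.

(* completely_regular_space is phrased with uniform separators; this is the
   equivalence with the usual definition by real-valued continuous functions *)
Lemma tychonoff_spaceP (R : realType) : tychonoff_space <->
  (forall (a : X) (B : set X), closed B -> ~ B a ->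
    exists f : X -> R, [/\ continuous f, range f `<=` `[0, 1],
      f a = 0 & forall b, B b -> f b = 1]) /\ hausdorff_space X.
Proof.
split=> -[cr hX]; split=> // a B cB Ba.
  have /(@uniform_separatorP _ R)[f [fc f01 fa fB]] := cr a B cB Ba.
  exists f; split=> //; first by apply: fa; exists a.
  by move=> b Bb; apply: fB; exists b.
apply/(@uniform_separatorP _ R); have [f [fc f01 fa fB]] := cr a B cB Ba.
exists f; split=> //; first by move=> _ [_ -> <-].
by move=> _ [b Bb <-]; exact: fB.
Qed.

End tychonoff_space.
Arguments tychonoff_space : clear implicits.

Section ptws_tvs.
Context (R : numFieldType) (I : Type) (E : tvsType R).

Local Notation W := {ptws I -> E}.

HB.instance Definition _ := GRing.Lmodule.copy W (I -> E).

Lemma ptws_cvgP (F : set_system W) (f : W) : Filter F ->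
  F --> f <-> forall i, (fun g : W => g i) @ F --> f i.
Proof.
move=> FF; split=> [/cvg_sup Ff i A|Ff].
  rewrite nbhsE/= => -[B [oB Bf] BA]; apply: (Ff i).
  exists ((fun g : W => g i) @^-1` B); split=> //; first by exists B.
  by move=> g /BA.
apply/cvg_sup => i A /= [_ [[B oB <-] Bf] BA].
by apply: filterS BA _; apply: Ff; exact: open_nbhs_nbhs.
Qed.

Lemma ptws_ev_continuous (i : I) : continuous (fun g : W => g i).
Proof. by move=> f; exact: (ptws_cvgP f (nbhs_filter f)).1. Qed.

Let ptws_add_continuous : continuous (fun x : W * W => x.1 + x.2).
Proof.
move=> [f g]; apply/ptws_cvgP => i.
apply: (@continuous_comp _ _ _ (fun x : W * W => (x.1 i, x.2 i))
  (fun x : E * E => x.1 + x.2)); last exact: add_continuous.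
apply: cvg_pair => /=.
- apply: (@cvg_comp _ _ _ fst (fun g : W => g i)); first exact: cvg_fst.
  exact: ptws_ev_continuous.
- apply: (@cvg_comp _ _ _ snd (fun g : W => g i)); first exact: cvg_snd.
  exact: ptws_ev_continuous.
Qed.

Let ptws_scale_continuous : continuous (fun x : R^o * W => x.1 *: x.2).
Proof.
move=> [k f]; apply/ptws_cvgP => i.
apply: (@continuous_comp _ _ _ (fun x : R^o * W => (x.1, x.2 i))
  (fun x : R^o * E => x.1 *: x.2)); last exact: scale_continuous.
have H1 : (fun x : R^o * W => x.1) @ (k, f) --> k by exact: cvg_fst.
have H2 : (fun x : R^o * W => x.2 i) @ (k, f) --> f i.
  apply: (@cvg_comp _ _ _ snd (fun g : W => g i)); first exact: cvg_snd.
  exact: ptws_ev_continuous. 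
exact: (cvg_pair H1 H2).
Qed.

Let ptws_locally_convex : exists2 B : set_system W,
  (forall b, b \in B -> convex_set b) & basis B.
Proof.
pose B : set_system W := [set b | open b /\ convex_set b].
exists B; first by move=> b /[!inE] -[].
split=> [b []//|f].
have FF : Filter (filter_from [set U | B U /\ U f] id).
  apply: filter_from_filter.
    exists setT; split=> //; split; first exact: openT.
    by move=> ? ? ?; rewrite !inE.
  move=> U V [[oU cU] Uf] [[oV cV] Vf]; exists (U `&` V) => //.
  split=> //; split; first exact: openI.
  move=> x y l /[!inE] -[Ux Vx] [Uy Vy]; split.
  - by apply: set_mem; apply: cU; rewrite inE.
  - by apply: set_mem; apply: cV; rewrite inE.
apply/ptws_cvgP => i A fA.
have [C cC [oC /(_ (f i) A fA)[D /= [CD Df] DA]]] := @locally_convex R E.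
exists ((fun g : W => g i) @^-1` D) => [/=|g]; last exact: DA.
split=> //; split.
  by apply: open_comp; [move=> ? _; exact: ptws_ev_continuous|exact: oC].
move=> x y l /[!inE]/= Dx Dy.
by apply: set_mem; apply: (cC D); rewrite inE.
Qed.

HB.instance Definition _ :=
  PreTopologicalNmodule_isTopologicalNmodule.Build W ptws_add_continuous.
HB.instance Definition _ :=
  TopologicalNmodule_isTopologicalLmodule.Build R W ptws_scale_continuous.
HB.instance Definition _ := Uniform_isTvs.Build R W ptws_locally_convex.

End ptws_tvs.

Lemma initial_cvgP (S : choiceType) (T : topologicalType) (f : S -> T)
    (F : set_system (initial_topology f)) (x : initial_topology f) :
  Filter F -> F --> x <-> f @ F --> f x.
Proof.
move=> FF; split=> [Fx|Ffx].
  by apply: cvg_comp Fx _; exact: initial_continuous.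
move=> A /= [_ [[B oB <-] Bx] BA].
by apply: filterS BA _; apply: Ffx; exact: open_nbhs_nbhs.
Qed.

Section initial_tvs.
Context (R : numFieldType) (V : lmodType R) (E : tvsType R).
Variable f : {linear V -> E}.

Local Notation W := (initial_topology f).

HB.instance Definition _ := GRing.Lmodule.copy W V.

Let initial_add_continuous : continuous (fun x : W * W => x.1 + x.2).
Proof.
move=> [x y]; apply/initial_cvgP.
have -> : f ((x, y).1 + (x, y).2) = f x + f y by rewrite /= linearD.
have H1 : (fun z : W * W => f z.1) @ (x, y) --> f x.
  apply: (@cvg_comp _ _ _ fst (f : W -> E)); first exact: cvg_fst.
  exact: initial_continuous.
have H2 : (fun z : W * W => f z.2) @ (x, y) --> f y.
  apply: (@cvg_comp _ _ _ snd (f : W -> E)); first exact: cvg_snd.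
  exact: initial_continuous.
have H : (fun z : W * W => f z.1 + f z.2) @ (x, y) --> f x + f y.
  exact: (cvg_comp _ _ (cvg_pair H1 H2) (@add_continuous E (f x, f y))).
rewrite (_ : (fun z => _) = (fun z : W * W => f (z.1 + z.2))) in H => //.
by apply/funext => z; rewrite linearD.
Qed.

Let initial_scale_continuous : continuous (fun x : R^o * W => x.1 *: x.2).
Proof.
move=> [k x]; apply/initial_cvgP.
have -> : f ((k, x).1 *: (k, x).2) = k *: f x by rewrite /= linearZ.
have H1 : (fun z : R^o * W => z.1) @ (k, x) --> k by exact: cvg_fst.
have H2 : (fun z : R^o * W => f z.2) @ (k, x) --> f x.
  apply: (@cvg_comp _ _ _ snd (f : W -> E)); first exact: cvg_snd.
  exact: initial_continuous.
have H : (fun z : R^o * W => z.1 *: f z.2) @ (k, x) --> k *: f x.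
  exact: (cvg_comp _ _ (cvg_pair H1 H2) (@scale_continuous R E (k, f x))).
rewrite (_ : (fun z => _) = (fun z : R^o * W => f (z.1 *: z.2))) in H => //.
by apply/funext => z; rewrite linearZ.
Qed.

Let initial_locally_convex : exists2 B : set_system W,
  (forall b, b \in B -> convex_set b) & basis B.
Proof.
have [C cC [oC bC]] := @locally_convex R E.
exists [set f @^-1` D | D in C].
  move=> _ /[!inE] -[D CD <-] x y l /[!inE]/= Dx Dy.
  have -> : f (conv l (x : convex_lmodType W) y) =
            conv l (f x : convex_lmodType E) (f y).
    by rewrite /conv/= linearD !linearZ.
  by apply: set_mem; apply: (cC D); rewrite inE.
split=> [_ [D CD <-]|x A /= [_ [[B oB <-] Bx] BA]].
  by exists D => //; exact: oC.
have [D /= [CD Dx] DB] := bC (f x) B (open_nbhs_nbhs (conj oB Bx)).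
exists (f @^-1` D); first by split=> //; exists D.
by move=> z Dz; apply: BA; exact: DB.
Qed.

HB.instance Definition _ :=
  PreTopologicalNmodule_isTopologicalNmodule.Build W initial_add_continuous.
HB.instance Definition _ :=
  TopologicalNmodule_isTopologicalLmodule.Build R W initial_scale_continuous.
HB.instance Definition _ := Uniform_isTvs.Build R W initial_locally_convex.

End initial_tvs.

Section Cp.
Context (R : numFieldType) (X : topologicalType) (E : tvsType R).

Definition Cp : Type := continuousType X E.

Definition Cp_pred : {pred X -> E} := mem [set f | continuous f].

Let Cp_Sub (f : X -> E) (fP : f \in Cp_pred) : Cp := mkcts (set_mem fP).

Let Cp_rect (K : Cp -> Type) :
  (forall f (Pf : f \in Cp_pred), K (Cp_Sub Pf)) -> forall u : Cp, K u.
Proof.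
move=> KS u; have uP : ((u : continuousType X E) : X -> E) \in Cp_pred.
  by rewrite inE/=; exact: cts_fun.
by rewrite (_ : u = Cp_Sub uP)//; exact/continuousEP.
Qed.

Let Cp_SubK f (Pf : f \in Cp_pred) :
  (Cp_Sub Pf : continuousType X E) = f :> (X -> E).
Proof. by []. Qed.

HB.instance Definition _ :=
  isSub.Build (X -> E) (fun f => f \in Cp_pred) Cp Cp_rect Cp_SubK.
HB.instance Definition _ := [Choice of Cp by <:].

Let Cp_submod_closed : submod_closed Cp_pred.
Proof.
split; first by rewrite inE/=; exact: cst_continuous.
move=> k f g /[!inE]/= cf cg x.
have kf : (fun y => k *: f y) @ x --> k *: f x.
  have ck : (fun=> k : R^o) @ x --> (k : R^o) by exact: cvg_cst.
  exact: (cvg_comp _ _ (cvg_pair ck (cf x)) (@scale_continuous R E (k, f x))).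
exact: (cvg_comp _ _ (cvg_pair kf (cg x)) (@add_continuous E (k *: f x, g x))).
Qed.

HB.instance Definition _ :=
  GRing.isSubmodClosed.Build R (X -> E) Cp_pred Cp_submod_closed.
HB.instance Definition _ := [SubChoice_isSubLmodule of Cp by <:].
HB.instance Definition _ :=
  Tvs.copy Cp (initial_topology (\val : Cp -> {ptws X -> E})).

Lemma Cp_cvgP (F : set_system Cp) (f : Cp) : Filter F ->
  F --> f <-> forall x, (fun g : Cp => \val g x) @ F --> \val f x.
Proof.
move=> FF; split=> [Ff x|Ff].
  have /initial_cvgP/ptws_cvgP := Ff; exact.
by apply/initial_cvgP/ptws_cvgP => x; exact: Ff.
Qed.

End Cp.

Section c0p.
Variable R : realType.

Definition c0p_pred : {pred nat -> R^o} := mem [set x | x @ \oo --> (0 : R^o)].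

Definition c0p : Type := {x : nat -> R^o | x \in c0p_pred}.

HB.instance Definition _ := SubChoice.copy c0p {x : nat -> R^o | x \in c0p_pred}.

Let c0p_submod_closed : submod_closed c0p_pred.
Proof.
split; first by rewrite inE/=; exact: cvg_cst.
move=> k x y /[!inE]/= x0 y0.
have kx : (fun n => k *: x n) @ \oo --> k *: (0 : R^o).
  have ck : (fun=> k : R^o) @ \oo --> (k : R^o) by exact: cvg_cst.
  exact: (cvg_comp _ _ (cvg_pair ck x0) (@scale_continuous R R^o (k, 0))).
have := cvg_comp _ _ (cvg_pair kx y0) (@add_continuous R^o (k *: 0, 0)).
by rewrite /= scaler0 addr0; apply.
Qed.

HB.instance Definition _ :=
  GRing.isSubmodClosed.Build R (nat -> R^o) c0p_pred c0p_submod_closed.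
HB.instance Definition _ := [SubChoice_isSubLmodule of c0p by <:].
HB.instance Definition _ :=
  Tvs.copy c0p (initial_topology (\val : c0p -> {ptws nat -> R^o})).

End c0p.

Section complemented_copy.
Context (R : numFieldType) (E F : tvsType R).

Definition continuous_linear_surjection_onto :=
  exists f : {linear E -> F}, continuous f /\ range f = [set: F].

Definition direct_sum_decomposition (E1 E2 : set E) :=
  [/\ submod_closed (mem E1), submod_closed (mem E2),
      E1 `&` E2 = [set 0] & [set u + v | u in E1 & v in E2] = [set: E]].

(* h, restricted to E1, is the inverse of g : F -> E1; its values outside E1 are
   irrelevant *)
Definition linearly_homeomorphic_to (E1 : set E) :=
  exists g : {linear F -> E}, [/\ continuous g, range g = E1 &
    exists h : E -> F, cancel g h /\ {within E1, continuous h}].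

(* P is the projection onto E1 along E2; its continuity as a map to E1 with
   the subspace topology is its continuity as a map to E *)
Definition contains_complemented_copy :=
  exists E1 E2 : set E, [/\ closed E1, closed E2,
    direct_sum_decomposition E1 E2,
    linearly_homeomorphic_to E1 &
    exists P : E -> E, (forall u v, E1 u -> E2 v -> P (u + v) = u) /\
      continuous P].

End complemented_copy.

Section barrel.
Context (R : numFieldType) (E : tvsType R).
Implicit Types A B : set E.

Definition balanced A := forall (a : R) x, `|a| <= 1 -> A x -> A (a *: x).

Definition absolutely_convex A := convex_set A /\ balanced A.

Definition absorbs A B :=
  exists2 r : R, 0 < r & forall a : R, r <= `|a| -> B `<=` *:%R a @` A.

Definition absorbing A := forall x, absorbs A [set x].

Definition barrel A := [/\ closed A, absolutely_convex A & absorbing A].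

Definition barrel_bounded B := forall A, barrel A -> absorbs A B.

End barrel.

Section dual.
Context (R : numFieldType) (E : tvsType R).

Definition dual_pred : {pred E -> R^o} := mem [set f | linear f /\ continuous f].

Definition dual : Type := {f : E -> R^o | f \in dual_pred}.

HB.instance Definition _ := SubChoice.copy dual {f : E -> R^o | f \in dual_pred}.

Let dual_submod_closed : submod_closed dual_pred.
Proof.
split.
  rewrite inE/=; split; last exact: cst_continuous.
  by move=> k x y; rewrite -[RHS]/(k *: 0 + 0 : R^o) scaler0 addr0.
move=> k f g; rewrite !inE/= => -[lf cf] [lg cg]; split.
  move=> a x y; rewrite -[LHS]/(k *: f (a *: x + y) + g (a *: x + y)).
  rewrite -[RHS]/(a *: (k *: f x + g x) + (k *: f y + g y)).
  rewrite lf lg !scalerDr !scalerA (mulrC k a) -!addrA; congr (_ + _).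
  by rewrite addrCA.
move=> x.
have kf : (fun y => k *: f y) @ x --> k *: f x.
  have ck : (fun=> k : R^o) @ x --> (k : R^o) by exact: cvg_cst.
  exact: (cvg_comp _ _ (cvg_pair ck (cf x))
    (@scale_continuous R R^o (k, f x))).
exact: (cvg_comp _ _ (cvg_pair kf (cg x))
  (@add_continuous R^o (k *: f x, g x))).
Qed.

HB.instance Definition _ :=
  GRing.isSubmodClosed.Build R (E -> R^o) dual_pred dual_submod_closed.
HB.instance Definition _ := [SubChoice_isSubLmodule of dual by <:].

(* sigma(E', E) *)
Definition weak_star_dual : topologicalType :=
  initial_topology (\val : dual -> {ptws E -> R^o}).

(* beta^*(E', E) *)
Definition beta_star_dual : topologicalType :=
  initial_topology (\val : dual -> {family @barrel_bounded R E, E -> R^o}).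

End dual.

Definition sequentially_continuous (S T : topologicalType) (f : S -> T) :=
  forall (u : nat -> S) (x : S), u @ \oo --> x -> (f \o u) @ \oo --> f x.

Section JNP.
Context (R : numFieldType) (E : tvsType R).
Implicit Types (u : nat -> dual E) (f : dual E).

Definition JNP :=
  ~ sequentially_continuous (id : weak_star_dual E -> beta_star_dual E).

Lemma weak_star_cvgP u f : u @ \oo --> (f : weak_star_dual E) <->
  forall x, \val (u n) x @[n --> \oo] --> \val f x.
Proof.
split=> [uf x|uf].
  have /initial_cvgP/ptws_cvgP := uf; exact.
by apply/initial_cvgP/ptws_cvgP => x; exact: uf.
Qed.

Lemma beta_star_cvgP u f : u @ \oo --> (f : beta_star_dual E) <->
  forall B, barrel_bounded B -> forall e : R, 0 < e ->
  \forall n \near \oo, forall x, B x -> `|\val f x - \val (u n) x| < e.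
Proof.
split=> [uf B bB e e0|uf].
  have /initial_cvgP/fam_cvgP/(_ B bB) := uf.
  move=> /(_ [set h | forall x, B x -> ball (\val f x) e (h x)]); apply.
  apply/uniform_nbhs; exists [set xy | ball xy.1 e xy.2]; split=> //.
  exact: entourage_ball (PosNum e0).
apply/initial_cvgP/fam_cvgP => B bB P /uniform_nbhs[A [+ AP]].
rewrite -entourage_ballE => -[e /= e0 eA].
apply: filterS (uf B bB e e0) => n une; apply: AP => x Bx.
by apply: eA => /=; exact: une.
Qed.

Lemma JNPP : JNP <-> exists u,
  u @ \oo --> (0 : weak_star_dual E) /\ ~ u @ \oo --> (0 : beta_star_dual E).
Proof.
split=> [/existsNP[u /existsNP[f /not_implyP[uf nuf]]]|[u [u0 nu0]] sc].
  exists (fun n => u n - f : dual E); split.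
    apply/weak_star_cvgP => x; have /weak_star_cvgP/(_ x) ufx := uf.
    have : (fun n => \val (u n) x - \val f x) @ \oo --> \val f x - \val f x.
      exact: (cvgB ufx (cvg_cst (\val f x))).
    by rewrite subrr.
  move/beta_star_cvgP => u0; apply: nuf; apply/beta_star_cvgP => B bB e e0.
  apply: filterS (u0 B bB e e0) => n + x Bx => /(_ x Bx).
  by rewrite [X in `|X|](_ : _ = \val f x - \val (u n) x)// sub0r opprB.
by apply: nu0; exact: sc u0.
Qed.

End JNP.

(* Main.v *)
Require Import Defs.
From HB Require Import structures.
From mathcomp Require Import all_boot all_order all_algebra.
From mathcomp Require Import all_classical all_reals all_analysis.
From mathcomp Require Import ring lra.

(** All the function spaces involved have the form C_p(Z). A function X -> C_p(Y)
    is continuous exactly when the function of two variables that it defines is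
    separately continuous, that is, continuous for the cross topology on X * Y, in
    which a set is open when all its sections along lines are open. So
    C_p(X, C_p(Y)) is C_p of X * Y with the cross topology, a space which need not be
    completely regular but whose points are separated by real continuous functions.
    Only that separation is used of Z (predicate [separates_points]), and
    [models_Cp] says that a locally convex space is C_p(Z).

    The dual of C_p(Z) consists of the finitely supported measures on Z
    ([dual_fsmeasure]). For each Z, the property JNP, the existence of a complemented
    copy of (c_0)_p and the existence of a continuous linear surjection onto (c_0)_p
    all amount to the existence of a Josefson-Nissenzweig sequence: measures mu_n of
    norm 1 such that mu_n(h) -> 0 for every continuous h.

    - A gliding hump shows that every continuous function is bounded on the union of
      the supports of a weakly null sequence ([weak_null_bounded_support]). If the
      norms tended to 0, the sequence would therefore be uniformly small on every
      barrel-bounded set, and it could not be the sequence of coordinates of a map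
      onto (c_0)_p. Hence the property JNP and a surjection each yield a weakly null
      sequence whose norms do not tend to 0, and then a normalized one
      ([JN_sequence_of_JNP], [JN_sequence_of_surjection]).
    - Conversely the functions bounded by 1 form a barrel-bounded set, by a Baire
      category argument ([unit_ball_barrel_bounded]), and the norm of a measure is its
      supremum on that set: hence the property JNP ([JNP_of_JN_sequence]).
    - The mass of a Josefson-Nissenzweig sequence leaves every finite set
      ([mass_escapes]). Passing to subsequences, this gives measures nu_j and uniformly
      bounded functions f_j with disjoint supports such that the matrix nu_j(f_i) is
      lower triangular with unit diagonal and small entries below it
      ([biorthogonal_system]). Solving the triangular system gives a continuous map
      onto (c_0)_p with right inverse x |-> sum of the x_j f_j
      ([complemented_copy_of_JN_sequence]).

    It remains to compare X, Y and their product. A Josefson-Nissenzweig sequence on X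
    or on Y is pushed forward to a line of the product. In the other direction, the
    supports of a weakly null sequence on the product lie on finitely many lines:
    otherwise they contain points (x_i, y_i) with all x_i distinct and all y_i
    distinct, and some separately continuous function is unbounded on them
    ([unbounded_on_matching]). Since the mass also leaves the finitely many
    intersection points of these lines, it does not vanish on one of the lines, and
    weighting the measures by a continuous function that selects this line gives a
    sequence on X or on Y ([JN_sequence_of_cross]). *)

Import Order.TTheory GRing.Theory Num.Theory.
Import numFieldNormedType.Exports.
Set Implicit Arguments.
Unset Strict Implicit.
Unset Printing Implicit Defensive.
Local Open Scope classical_set_scope.
Local Open Scope ring_scope.

(** * Sequences *)

Lemma strictly_increasing_ge (f : nat -> nat) :
  (forall j, (f j < f j.+1)%N) -> forall j, (j <= f j)%N.
Proof. by move=> fS; elim=> [//|j IH]; exact: leq_ltn_trans IH (fS j). Qed.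

Lemma strictly_increasing_mono (f : nat -> nat) :
  (forall j, (f j < f j.+1)%N) -> forall i j, (i < j)%N -> (f i < f j)%N.
Proof.
move=> fS i j.
exact: (@homo_ltn _ f (fun m n => (m < n)%N) (fun n m p => @ltn_trans n m p) fS).
Qed.

Lemma strictly_increasing_inj (f : nat -> nat) :
  (forall j, (f j < f j.+1)%N) -> injective f.
Proof.
move=> /strictly_increasing_mono fmono i j fij.
by case: (ltngtP i j) => // /fmono; rewrite fij ltnn.
Qed.

(** The next index is taken beyond the thresholds of all numbers up to the current
    index, hence beyond those of all the indices chosen before. *)
Lemma diagonal_subsequence (P : nat -> nat -> Prop) :
  (forall p, \forall i \near \oo, P p i) ->
  exists2 iota : nat -> nat, (forall j, (iota j < iota j.+1)%N) &
    forall j k, (j < k)%N -> P (iota j) (iota k).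
Proof.
move=> nearP; have /choice[N NP] : forall p, exists N, forall i, (N <= i)%N -> P p i.
  by move=> p; have [N _ NP] := nearP p; exists N.
pose fix f j := if j is j'.+1 then (f j' + \sum_(q < (f j').+1) N q).+1 else 0%N.
have fS j : (f j < f j.+1)%N by rewrite /= ltnS leq_addr.
have fmono j k : (j <= k)%N -> (f j <= f k)%N.
  exact: (@homo_leq _ f (fun m n => (m <= n)%N) leqnn (fun n m p => @leq_trans n m p)
    (fun j => ltnW (fS j))).
exists f => // j [//|k]; rewrite ltnS => jk; apply: NP => /=.
rewrite (bigD1 (Ordinal (fmono _ _ jk : (f j < (f k).+1)%N)))//=.
by rewrite addnCA; apply: leqW; rewrite leq_addr.
Qed.

Definition unbounded (N : set nat) := forall m, exists2 k, (m <= k)%N & N k.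

Lemma unbounded_seq (N : set nat) (M m : nat) : unbounded N ->
  exists s : seq nat, [/\ uniq s, size s = M & {in s, forall k, N k /\ (m <= k)%N}].
Proof.
move=> uN; elim: M m => [|M IH] m; first by exists [::].
have [k mk Nk] := uN m; have [s [us ss sN]] := IH k.+1.
exists (k :: s); split; last 1 first.
- move=> i; rewrite inE => /predU1P[->//|/sN[Ni ki]]; split=> //.
  by apply: leq_trans mk _; exact: ltnW.
- rewrite /= us andbT; apply/negP => /sN[_]; by rewrite ltnn.
- by rewrite /= ss.
Qed.

Lemma cvg_sum0 {R : realType} (I : Type) (s : seq I) (F : I -> nat -> R) :
  (forall i, F i n @[n --> \oo] --> (0 : R)) ->
  \sum_(i <- s) F i n @[n --> \oo] --> (0 : R).
Proof.
move=> F0; elim: s => [|i s IH].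
  by under eq_fun do rewrite big_nil; exact: cvg_cst.
under eq_fun do rewrite big_cons.
by have := cvgD (F0 i) IH; rewrite addr0; apply.
Qed.

Lemma cvg0_le {R : realType} (u v : nat -> R) :
  (forall n, 0 <= u n <= v n) -> v @ \oo --> (0 : R) -> u @ \oo --> (0 : R).
Proof.
move=> uv v0; apply/cvgr0Pnorm_le => e e0; have /cvgr0Pnorm_le/(_ e e0) := v0.
apply: filterS => n; have /andP[u0 ule] := uv n.
by rewrite !ger0_norm ?(le_trans u0)//; exact: le_trans.
Qed.

(** * Real continuous functions *)

Section continuous_functions.
Context {R : realType} {Z : topologicalType}.
Implicit Types f g : Z -> R.

Lemma continuous_add f g : continuous f -> continuous g ->
  continuous (fun z => f z + g z).
Proof. by move=> cf cg z; exact: (cvgD (cf z) (cg z)). Qed.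

Lemma continuous_mul f g : continuous f -> continuous g ->
  continuous (fun z => f z * g z).
Proof. by move=> cf cg z; exact: (cvgM (cf z) (cg z)). Qed.

Lemma continuous_const (c : R) : continuous (fun _ : Z => c).
Proof. by move=> z; exact: cvg_cst. Qed.

Lemma continuous_scale (c : R) f : continuous f -> continuous (fun z => c * f z).
Proof. by apply: continuous_mul; exact: continuous_const. Qed.

Lemma continuous_sub f g : continuous f -> continuous g ->
  continuous (fun z => f z - g z).
Proof. by move=> cf cg z; exact: (cvgB (cf z) (cg z)). Qed.

Lemma continuous_norm f : continuous f -> continuous (fun z => `|f z|).
Proof. by move=> cf z; exact: (cvg_norm (cf z)). Qed.

Lemma continuous_maxr f g : continuous f -> continuous g ->
  continuous (fun z => Num.max (f z) (g z)).
Proof. by move=> cf cg; exact: max_fun_continuous. Qed.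

Lemma continuous_minr f g : continuous f -> continuous g ->
  continuous (fun z => Num.min (f z) (g z)).
Proof. by move=> cf cg; exact: min_fun_continuous. Qed.

Lemma continuous_sum (I : Type) (s : seq I) (F : I -> Z -> R) :
  (forall i, continuous (F i)) -> continuous (fun z => \sum_(i <- s) F i z).
Proof.
move=> cF; elim: s => [|i s IH].
  by under eq_fun do rewrite big_nil; exact: continuous_const.
by under eq_fun do rewrite big_cons; exact: continuous_add.
Qed.

Lemma continuous_prod (I : Type) (s : seq I) (F : I -> Z -> R) :
  (forall i, continuous (F i)) -> continuous (fun z => \prod_(i <- s) F i z).
Proof.
move=> cF; elim: s => [|i s IH].
  by under eq_fun do rewrite big_nil; exact: continuous_const.
by under eq_fun do rewrite big_cons; exact: continuous_mul.
Qed.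

Lemma continuous_of_uniform_approximation g :
  (forall e : R, 0 < e -> exists2 h : Z -> R, continuous h &
     forall z, `|g z - h z| <= e) ->
  continuous g.
Proof.
move=> approx z; apply/cvgrPdist_lt => e e0.
have e3 : 0 < e / 3 by rewrite divr_gt0.
have [h ch gh] := approx _ e3.
have /cvgrPdist_lt/(_ _ e3) := ch z.
apply: filterS => x hzx.
have := gh z; have := gh x.
rewrite distrC => h1 h2.
have -> : g z - g x = (g z - h z) + (h z - h x) + (h x - g x) by ring.
apply: le_lt_trans (ler_normD _ _) _.
apply: le_lt_trans (lerD (ler_normD _ _) (lexx _)) _.
lra.
Qed.

End continuous_functions.

(** * Tents and interpolation *)
Section tent.
Context {R : realType}.

(** The support has width 1, so that the translates of [tent] by integers have
    disjoint supports: this turns one interpolating function into a family of bumps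
    with disjoint supports. *)
Definition tent (t : R) : R := Num.max 0 (1 - 2 * `|t|).

Lemma tent0 : tent 0 = 1.
Proof. by rewrite /tent normr0 mulr0 subr0 max_r. Qed.

Lemma tent_ge0 t : 0 <= tent t.
Proof. by rewrite /tent le_max lexx. Qed.

Lemma tent_le1 t : tent t <= 1.
Proof. by rewrite /tent ge_max ler01/= gerBl mulr_ge0. Qed.

Lemma tent_neq0 t : (tent t != 0) = (`|t| < 1 / 2).
Proof.
rewrite /tent; case: (ltP `|t| (1 / 2)) => t2.
  rewrite max_r; last by lra.
  by apply: lt0r_neq0; lra.
by rewrite max_l ?eqxx//; lra.
Qed.

Lemma tent_apart t u : 1 <= `|u - t| -> tent t != 0 -> tent u = 0.
Proof.
move=> tu; rewrite tent_neq0 => t2; apply/eqP; apply/negPn; rewrite tent_neq0.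
rewrite -leNgt; have := ler_normB (u - t) (- t); rewrite opprK subrK normrN.
have := ler_normD u (- t); rewrite normrN; lra.
Qed.

Lemma natr_dist (i j : nat) : i != j -> 1 <= `|i%:R - j%:R : R|.
Proof.
wlog ij : i j / (i < j)%N.
  move=> H; rewrite neq_ltn => /orP[ij|ji].
    by apply: H => //; rewrite ltn_eqF.
  by rewrite distrC; apply: H => //; rewrite ltn_eqF.
move=> _; rewrite distrC -natrB ?(ltnW ij)// normr_nat ler1n subn_gt0.
exact: ij.
Qed.

Lemma tent_disjoint t (i j : nat) : i != j ->
  tent (t - i%:R) != 0 -> tent (t - j%:R) = 0.
Proof.
move=> ij; apply: tent_apart.
by rewrite (_ : _ - _ - _ = i%:R - j%:R); [exact: natr_dist|ring].
Qed.

Lemma sum_tent_support t (s : seq nat) : uniq s ->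
  \sum_(i <- s) (tent (t - i%:R) != 0)%:R <= 1 :> R.
Proof.
elim: s => [|i s IH] /=; first by rewrite big_nil.
case/andP => iNs us; rewrite big_cons.
have [_|ti] := eqVneq (tent (t - i%:R)) 0; first by rewrite add0r; exact: IH.
rewrite big1_seq ?addr0// => j /= js.
rewrite (tent_disjoint _ ti) ?eqxx//.
by apply: contraNneq iNs => ->.
Qed.

Lemma continuous_tent {Z : topologicalType} (f : Z -> R) : continuous f ->
  continuous (fun z => tent (f z)).
Proof.
move=> cf; apply: continuous_maxr; first exact: continuous_const.
apply: continuous_sub; first exact: continuous_const.
by apply: continuous_scale; exact: continuous_norm.
Qed.

End tent.

Section interpolation.
Context {R : realType} {Z : topologicalType}.

(** The Tychonoff property is too strong here: the cross topology on a product need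
    not be completely regular. *)
Definition separates_points := forall x y : Z, x <> y ->
  exists2 h : Z -> R, continuous h & h x <> h y.

Hypothesis sepZ : separates_points.

Lemma bump (s : seq Z) (x : Z) : x \notin s ->
  exists h : Z -> R, [/\ continuous h, h x = 1 & {in s, forall z, h z = 0}].
Proof.
elim: s => [_|y s IH].
  by exists (fun=> 1); split=> //; exact: continuous_const.
rewrite inE negb_or => /andP[/eqP xy /IH[h [ch hx hs]]].
have [g cg gxy] := sepZ xy.
have gxy0 : g x - g y != 0 by rewrite subr_eq0; apply/eqP.
exists (fun z => h z * ((g x - g y)^-1 * (g z - g y))); split.
- apply: continuous_mul => //; apply: continuous_scale.
  by apply: continuous_sub => //; exact: continuous_const.
- by rewrite hx mul1r mulVf.
- move=> z; rewrite inE => /predU1P[->|/hs ->]; last by rewrite mul0r.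
  by rewrite subrr !mulr0.
Qed.

Lemma interpolation (s : seq Z) (v : Z -> R) :
  exists2 h : Z -> R, continuous h & {in s, forall z, h z = v z}.
Proof.
elim: s => [|x s [h ch hs]]; first by exists (fun=> 0) => //; exact: continuous_const.
have [xs|xs] := boolP (x \in s).
  by exists h => // z; rewrite inE => /predU1P[->|]; exact: hs.
have [e [ce ex es]] := bump xs.
exists (fun z => h z + (v x - h x) * e z).
  by apply: continuous_add => //; exact: continuous_scale.
move=> z; rewrite inE => /predU1P[->|zs].
  by rewrite ex mulr1 addrC subrK.
by rewrite es// mulr0 addr0 hs.
Qed.

Lemma interpolation_le1 (s : seq Z) (v : Z -> R) : (forall z, `|v z| <= 1) ->
  exists h : Z -> R, [/\ continuous h, forall z, `|h z| <= 1 &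
    {in s, forall z, h z = v z}].
Proof.
move=> v1; have [h ch hs] := interpolation s v.
exists (fun z => Num.max (- 1) (Num.min 1 (h z))); split.
- apply: continuous_maxr; first exact: continuous_const.
  by apply: continuous_minr => //; exact: continuous_const.
- move=> z; rewrite ler_norml le_max lexx/= ge_max ge_min lexx/= andbT.
  lra.
- move=> z zs; rewrite hs//; have := v1 z; rewrite ler_norml => /andP[v1z vz1].
  by rewrite (min_r vz1) max_r.
Qed.

End interpolation.
Arguments separates_points : clear implicits.

(** * Finitely supported measures *)
Section finitely_supported_measure.
Context {R : realType}.

(** The list [supp] may contain points of weight 0; the weights outside [supp] are
    meaningless. *)
Record fsmeasure (Z : eqType) := FSMeasure {
  supp : seq Z;
  wt : Z -> R;
  supp_uniq : uniq supp }.

Definition integral_fs (Z : eqType) (m : fsmeasure Z) (h : Z -> R) : R :=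
  \sum_(z <- supp m) wt m z * h z.

(** Total variation; [mass m predT] is the norm of [m] as a functional on the bounded
    continuous functions. *)
Definition mass (Z : eqType) (m : fsmeasure Z) (P : pred Z) : R :=
  \sum_(z <- supp m | P z) `|wt m z|.

Context {Z : eqType}.
Implicit Types (m : fsmeasure Z) (h g : Z -> R) (P Q : pred Z).

Lemma eq_integral_fs m h g : {in supp m, h =1 g} ->
  integral_fs m h = integral_fs m g.
Proof. by move=> hg; apply: eq_big_seq => z zm; rewrite hg. Qed.

Lemma integral_fsD m h g :
  integral_fs m (fun z => h z + g z) = integral_fs m h + integral_fs m g.
Proof.
by rewrite /integral_fs -big_split/=; apply: eq_bigr => z _; rewrite mulrDr.
Qed.

Lemma integral_fsZ m c h :
  integral_fs m (fun z => c * h z) = c * integral_fs m h.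
Proof.
by rewrite /integral_fs big_distrr/=; apply: eq_bigr => z _; rewrite mulrCA.
Qed.

Lemma integral_fsB m h g :
  integral_fs m (fun z => h z - g z) = integral_fs m h - integral_fs m g.
Proof.
rewrite /integral_fs -sumrB.
by apply: eq_bigr => z _; rewrite mulrBr.
Qed.

Lemma integral_fs_sum (I : Type) (s : seq I) m (F : I -> Z -> R) :
  integral_fs m (fun z => \sum_(i <- s) F i z) =
  \sum_(i <- s) integral_fs m (F i).
Proof.
rewrite /integral_fs exchange_big/=; apply: eq_bigr => z _.
by rewrite big_distrr.
Qed.

Lemma mass_ge0 m P : 0 <= mass m P.
Proof. exact: sumr_ge0. Qed.

Lemma mass_split m P : mass m predT = mass m P + mass m (predC P).
Proof. by rewrite /mass (bigID P). Qed.

Lemma mass_sub m P Q : (forall z, P z -> Q z) -> mass m P <= mass m Q.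
Proof.
move=> PQ; rewrite /mass big_mkcond [leRHS]big_mkcond/=.
apply: ler_sum => z _; case: ifPn => [/PQ ->//|_]; case: ifP => //.
Qed.

Lemma normr_integral_fs m h (M : R) :
  {in supp m, forall z, wt m z != 0 -> `|h z| <= M} ->
  `|integral_fs m h| <= M * mass m predT.
Proof.
move=> hM; apply: le_trans (ler_norm_sum _ _ _) _.
rewrite /mass big_distrr/= [leLHS]big_seq [leRHS]big_seq; apply: ler_sum => z zm.
rewrite normrM mulrC; have [->|wz] := eqVneq (wt m z) 0.
  by rewrite normr0 !mulr0.
by apply: ler_wpM2r => //; exact: hM.
Qed.

Definition scale_fs (c : R) m : fsmeasure Z :=
  FSMeasure (fun z => c * wt m z) (supp_uniq m).

Lemma integral_scale_fs c m h :
  integral_fs (scale_fs c m) h = c * integral_fs m h.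
Proof.
by rewrite /integral_fs big_distrr/=; apply: eq_bigr => z _; rewrite mulrA.
Qed.

Lemma mass_scale_fs c m P : mass (scale_fs c m) P = `|c| * mass m P.
Proof.
by rewrite /mass big_distrr/=; apply: eq_bigr => z _; rewrite normrM.
Qed.

End finitely_supported_measure.
Arguments fsmeasure : clear implicits.

(** * Josefson-Nissenzweig sequences *)
Section Josefson_Nissenzweig_sequences.
Context {R : realType} {Z : topologicalType}.
Implicit Types (m : fsmeasure R Z) (mu : nat -> fsmeasure R Z).

Definition weak_null mu := forall h : Z -> R, continuous h ->
  integral_fs (mu n) h @[n --> \oo] --> (0 : R).

Definition JN_sequence mu :=
  weak_null mu /\ forall n, mass (mu n) predT = 1.

Lemma weak_null_subseq mu (i : nat -> nat) : (forall n, (n <= i n)%N) ->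
  weak_null mu -> weak_null (mu \o i).
Proof.
move=> ni mu0 h ch; have := mu0 h ch => /cvgrPdist_lt mu0h.
apply/cvgrPdist_lt => e e0; have [N _ NP] := mu0h e e0.
by exists N => // n /= Nn; apply: NP => /=; exact: leq_trans (ni n).
Qed.

(** Along a subsequence the norms stay away from 0, and dividing by them preserves
    weak convergence. *)
Lemma JN_sequence_of_norm mu : weak_null mu ->
  ~ mass (mu n) predT @[n --> \oo] --> (0 : R) ->
  exists nu, JN_sequence nu.
Proof.
move=> mu0 nmu0.
have [e e0 big] : exists2 e : R, 0 < e &
    forall n, exists k, (n <= k)%N /\ e <= mass (mu k) predT.
  apply: contrapT => H; apply: nmu0; apply/cvgr0Pnorm_lt => e e0.
  apply: contrapT => He; apply: H; exists e => // n.
  apply: contrapT => Hn; apply: He; exists n => // k /= nk.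
  rewrite ger0_norm ?mass_ge0// ltNge; apply/negP => ek.
  by apply: Hn; exists k.
have {}[i ibig] := choice big.
have mpos n : 0 < mass (mu (i n)) predT.
  by apply: lt_le_trans e0 _; have [] := ibig n.
exists (fun n => scale_fs (mass (mu (i n)) predT)^-1 (mu (i n))); split; last first.
  move=> n; rewrite mass_scale_fs normfV ger0_norm ?mulVf ?gt_eqF//.
  exact: mass_ge0.
move=> h ch; have /cvgrPdist_lt := weak_null_subseq (fun n => (ibig n).1) mu0 ch.
move=> H; apply/cvgrPdist_lt => d d0.
have := H (d * e) (mulr_gt0 d0 e0); apply: filterS => n /=.
rewrite !sub0r !normrN integral_scale_fs normrM normfV (ger0_norm (mass_ge0 _ _)).
move=> lt1; rewrite -ltr_pdivlMl ?invr_gt0// invrK mulrC.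
by apply: lt_le_trans lt1 _; rewrite ler_pM2l//; have [] := ibig n.
Qed.

Hypothesis sepZ : separates_points R Z.

Lemma norming_function m : exists h : Z -> R,
  [/\ continuous h, forall z, `|h z| <= 1 &
      {in supp m, forall z, h z = Num.sg (wt m z)}].
Proof.
apply: (interpolation_le1 sepZ) => z.
by rewrite normr_sg; case: (_ != _).
Qed.

(** Let [e x], for [x] in [F], be bumps with disjoint supports. The sum [h] of the [e x],
    with the signs of the weights, is bounded by 1; its integral is small since each
    [e x] has a small integral, and it is at least the mass of [F] minus the mass
    outside. So the former exceeds the latter by at most 1/3 eventually, and they add
    up to 1. *)
Lemma mass_escapes mu (F : seq Z) : JN_sequence mu ->
  \forall n \near \oo, 1 / 3 <= mass (mu n) [pred z | z \notin F].
Proof.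
move=> [mu0 mu1]; pose s := undup F.
have [g cg gs] := interpolation sepZ s (fun z => (index z s)%:R).
pose e (x z : Z) : R := tent (g z - (index x s)%:R).
have ce x : continuous (e x).
  by apply: continuous_tent; apply: continuous_sub => //; exact: continuous_const.
have exx x : x \in s -> e x x = 1 by move=> xs; rewrite /e gs// subrr tent0.
have exy x y : x \in s -> y \in s -> x != y -> e x y = 0.
  move=> xs ys xy; apply: (@tent_disjoint _ _ (index y s)).
    apply: contraNneq xy => ixy; rewrite -(nth_index x xs) -(nth_index x ys).
    by rewrite ixy.
  by rewrite gs// subrr tent0 oner_eq0.
have sum_e z : \sum_(x <- s) e x z <= 1.
  have /sum_tent_support := iota_uniq 0 (size s).
  move=> /(_ R (g z)); apply: le_trans.
  have -> : iota 0 (size s) = [seq index x s | x <- s].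
    apply: (@eq_from_nth _ 0); first by rewrite size_iota size_map.
    move=> k; rewrite size_iota => ks; case: s {gs e ce exx exy} (undup_uniq F : uniq s) ks.
      by [].
    move=> x0 s us ks; rewrite nth_iota// add0n (nth_map x0)// index_uniq//.
  rewrite big_map; apply: ler_sum => x _; rewrite /e.
  case: eqVneq => [->//|_]; exact: tent_le1.
have sum0 : \sum_(x <- s) `|integral_fs (mu n) (e x)| @[n --> \oo] --> (0 : R).
  apply: cvg_sum0 => x.
  by have := cvg_norm (mu0 _ (ce x)); rewrite normr0; apply.
have /cvgrPdist_le/(_ (1/3)) := sum0.
case=> [|N _ NP]; first by rewrite divr_gt0.
exists N => // n /NP /=; rewrite sub0r normrN ger0_norm; last exact: sumr_ge0.
move=> small; pose h z := \sum_(x <- s) Num.sg (wt (mu n) x) * e x z.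
have hs : {in s, forall z, h z = Num.sg (wt (mu n) z)}.
  move=> z zs; rewrite /h (bigD1_seq z)//= ?undup_uniq// exx// mulr1.
  by rewrite big_seq_cond big1 ?addr0// => x /andP[xs xz]; rewrite exy// mulr0.
have h1 z : `|h z| <= 1.
  apply: le_trans (ler_norm_sum _ _ _) _; apply: le_trans _ (sum_e z).
  apply: ler_sum => x _; rewrite normrM (ger0_norm (tent_ge0 _)).
  rewrite ler_piMl ?tent_ge0// normr_sg; by case: (_ != _).
have int_h : integral_fs (mu n) h <= 1 / 3.
  rewrite integral_fs_sum; apply: le_trans small; apply: ler_sum => x _.
  rewrite integral_fsZ; apply: le_trans (ler_norm _) _.
  rewrite normrM ler_piMl// normr_sg; by case: (_ != _).
have : mass (mu n) [pred z | z \in F] - mass (mu n) [pred z | z \notin F] <=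
    integral_fs (mu n) h.
  rewrite /integral_fs (bigID [pred z | z \in F])/= lerD//.
    rewrite /mass; apply: ler_sum => z /= zF.
    by rewrite hs ?mem_undup// mulrC -normrEsg.
  rewrite -sumrN; apply: ler_sum => z _; rewrite lerNl.
  apply: le_trans (ler_norm _) _; rewrite normrN normrM.
  by rewrite ler_piMr.
have := mass_split (mu n) [pred z | z \in F]; rewrite mu1.
rewrite (_ : mass (mu n) (predC _) = mass (mu n) [pred z | z \notin F])//.
lra.
Qed.

End Josefson_Nissenzweig_sequences.
(** * Supports of weakly null sequences *)
Section bounded_supports.
Context {R : realType} {Z : topologicalType}.
Implicit Types mu : nat -> fsmeasure R Z.

(** Near each point, [f] is bounded by some [r k], so there the sequence [G] is
    stationary from a fixed index on. *)
Lemma glue_locally_stationary (f : Z -> R) (r : nat -> R) (G : nat -> Z -> R) :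
  continuous f -> (forall k, continuous (G k)) ->
  (forall k, k%:R <= r k) -> (forall k, r k <= r k.+1) ->
  (forall k z, `|f z| <= r k -> G k.+1 z = G k z) ->
  exists2 g : Z -> R, continuous g &
    forall k z, `|f z| <= r k -> g z = G k z.
Proof.
move=> cf cG kr rS GS.
have stat k j z : `|f z| <= r k -> G (j + k)%N z = G k z /\ `|f z| <= r (j + k)%N.
  move=> fk; elim: j => [//|j [IH rj]]; rewrite addSn GS//; split=> //.
  exact: le_trans rj (rS _).
have stat' k l z : `|f z| <= r k -> `|f z| <= r l -> G k z = G l z.
  move=> fk fl; have [<- _] := stat k l z fk; have [<- _] := stat l k z fl.
  by rewrite addnC.
pose K z := (Num.truncn `|f z|).+1.
have KP z : `|f z| < (K z)%:R by exact: truncnS_gt.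
have fK z : `|f z| <= r (K z) by apply: le_trans (ltW (KP z)) (kr _).
exists (fun z => G (K z) z) => [z|k z fk]; last exact: stat'.
have near_z x : `|f x| < `|f z| + 1 -> G (K x) x = G (K z).+1 x.
  move=> fx; apply: stat' => //; apply: le_trans (kr _).
  by rewrite -natr1; apply: ltW; apply: lt_trans fx _; rewrite ltrD2r.
have /cvgrPdist_lt near1 := @continuous_norm _ _ _ cf z.
apply/cvgrPdist_lt => e e0; rewrite near_z ?ltrDl//; have /cvgrPdist_lt/(_ e e0) := cG (K z).+1 z.
apply: filterS2 (near1 1 ltr01) => x fx; rewrite near_z//.
by move: fx; rewrite ltr_distlC => /andP[].
Qed.

Hypothesis sepZ : separates_points R Z.

(** Gliding hump. If [f] is unbounded on the supports, choose points [x k] in the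
    supports of the measures [mu (n k)] on which `|f| grows so fast that it exceeds by 1
    its maximum on all measures considered before. The functions [g k] live where `|f|
    is close to `|f (x k)|, so they form a locally finite family, and [g k] sees only
    [x k] in [mu (n k)] and nothing in earlier measures. A combination of them can
    therefore be chosen step by step to have integral 1 against every [mu (n k)]. *)
Lemma weak_null_bounded_support mu (f : Z -> R) :
  weak_null mu -> continuous f ->
  exists M, forall n, {in supp (mu n), forall z, wt (mu n) z != 0 -> `|f z| <= M}.
Proof.
move=> mu0 cf; apply: contrapT => unb.
have /choice[pick pickP] : forall r, exists p : nat * Z,
    [/\ p.2 \in supp (mu p.1), wt (mu p.1) p.2 != 0 & r + 1 < `|f p.2|].
  move=> r; apply: contrapT => H; apply: unb; exists (r + 1) => n z zn wz.
  by rewrite leNgt; apply/negP => rz; apply: H; exists (n, z).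
have /choice[b bP] : forall N, exists b, forall j, (j <= N)%N ->
    {in supp (mu j), forall z, `|f z| <= b}.
  move=> N; exists (\sum_(j < N.+1) \sum_(z <- supp (mu j)) `|f z|) => j jN z zj.
  rewrite (bigD1 (Ordinal (jN : (j < N.+1)%N)))//= (bigD1_seq z)//=; last exact: supp_uniq.
  by rewrite -addrA lerDl addr_ge0// sumr_ge0// => i _; exact: sumr_ge0.
(* [r k] bounds `|f| on the supports of all measures up to [mu (n k.-1)] *)
pose fix r k := if k is k'.+1 then b (pick (r k')).1 else 0.
pose n k := (pick (r k)).1; pose x k := (pick (r k)).2.
have xn k : x k \in supp (mu (n k)) by have [] := pickP (r k).
have wx k : wt (mu (n k)) (x k) != 0 by have [] := pickP (r k).
have fx k : r k + 1 < `|f (x k)| by have [] := pickP (r k).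
have rb k j z : (j <= n k)%N -> z \in supp (mu j) -> `|f z| <= r k.+1.
  by move=> jk zj; exact: (bP _ _ jk).
have r1 k : r k + 1 <= r k.+1.
  by apply: le_trans (ltW (fx k)) _; exact: (rb _ (n k)).
have kr k : k%:R <= r k.
  elim: k => [//|k IH]; rewrite -natr1; apply: le_trans (r1 k).
  by rewrite lerD2r.
have rS k : r k <= r k.+1 by apply: le_trans (r1 k); rewrite lerDl.
have nS k : (n k < n k.+1)%N.
  rewrite ltnNge; apply/negP => nk; have := rb k _ _ nk (xn k.+1).
  by apply/negP; rewrite -ltNge; apply: le_lt_trans (fx _); rewrite lerDl.
have ngek := strictly_increasing_ge nS.
have /choice[e eP] : forall k, exists e : Z -> R, [/\ continuous e, e (x k) = 1 &
    {in [seq z <- supp (mu (n k)) | z != x k], forall z, e z = 0}].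
  by move=> k; apply: (bump sepZ); rewrite mem_filter eqxx.
pose g k z := e k z * tent (`|f z| - `|f (x k)|).
have cg k : continuous (g k).
  apply: continuous_mul; first by have [] := eP k.
  apply: continuous_tent; apply: continuous_sub; first exact: continuous_norm.
  exact: continuous_const.
have g0 k z : `|f z| <= r k -> g k z = 0.
  move=> fz; rewrite /g (@tent_apart _ 0) ?mulr0 ?tent0 ?oner_neq0//.
  rewrite subr0 distrC; apply: le_trans (ler_norm _).
  have := fx k; lra.
have gx k : g k (x k) = 1 by rewrite /g subrr tent0 mulr1; have [] := eP k.
have gn k z : z \in supp (mu (n k)) -> z != x k -> g k z = 0.
  move=> zk zx; rewrite /g; have [_ _ ->] := eP k; first by rewrite mul0r.
  by rewrite mem_filter zx.
have int_g k : integral_fs (mu (n k)) (g k) = wt (mu (n k)) (x k).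
  rewrite /integral_fs (bigD1_seq (x k))//=; last exact: supp_uniq.
  rewrite gx mulr1 big_seq_cond big1 ?addr0// => z /andP[zk zx].
  by rewrite gn ?mulr0.
(* the coefficient of [g k] corrects the integral against [mu (n k)] to 1 *)
pose fix G k := if k is k'.+1 then fun z =>
    G k' z + (1 - integral_fs (mu (n k')) (G k')) / wt (mu (n k')) (x k') * g k' z
  else fun=> 0.
have cG k : continuous (G k).
  elim: k => [|k IH]; first exact: continuous_const.
  by apply: continuous_add => //; exact: continuous_scale.
have int_G k : integral_fs (mu (n k)) (G k.+1) = 1.
  by rewrite /= integral_fsD integral_fsZ int_g mulfVK// addrC subrK.
have [|h ch hG] := glue_locally_stationary cf cG kr rS.
  by move=> k z fz; rewrite /= g0// mulr0 addr0.
have int_h k : integral_fs (mu (n k)) h = 1.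
  rewrite -(int_G k); apply: eq_integral_fs => z zk; apply: hG.
  exact: (rb _ (n k)).
have /cvgrPdist_lt/(_ 1 ltr01)[N _ NP] := mu0 _ ch.
have := NP (n N) (ngek N); rewrite /= int_h sub0r normrN normr1.
by rewrite ltxx.
Qed.

Lemma weak_null_bounded_of_norm0 mu (f : Z -> R) :
  weak_null mu -> continuous f ->
  exists2 M, 0 <= M & forall n, `|integral_fs (mu n) f| <= M * mass (mu n) predT.
Proof.
move=> mu0 cf; have [M MP] := weak_null_bounded_support mu0 cf.
exists `|M| => // n; apply: normr_integral_fs => z zn wz.
by apply: le_trans (ler_norm _); exact: MP wz.
Qed.

End bounded_supports.
(** * Spaces of continuous functions and their duals *)
Section spaces_of_continuous_functions.
Context {R : realType}.

(** The map [ev] identifies [E] with C_p(Z), both as vector space and as topological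
    space. Working with a model allows C_p(X, C_p(Y)) to be handled as a space of
    functions on the product without transporting structures. *)
Record models_Cp (Z : topologicalType) (E : tvsType R) (ev : E -> Z -> R) : Prop :=
  ModelsCp {
    ev_linear : forall a u v z, ev (a *: u + v) z = a * ev u z + ev v z;
    ev_inj : forall u v, ev u = ev v -> u = v;
    ev_continuous : forall u, continuous (ev u);
    ev_onto : forall h : Z -> R, continuous h -> exists u, ev u = h;
    ev_cvg : forall (F : set_system E) (u : E), Filter F ->
      F --> u <-> forall z, ev v z @[v --> F] --> ev u z }.

Context {Z : topologicalType} {E : tvsType R} {ev : E -> Z -> R}.
Hypothesis evE : models_Cp ev.

Lemma ev0 z : ev 0 z = 0.
Proof.
have := ev_linear evE 1 0 0 z; rewrite scaler0 addr0 mul1r => /eqP.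
by rewrite -subr_eq0 opprD addrA subrr sub0r oppr_eq0 => /eqP.
Qed.

Lemma evZ a u z : ev (a *: u) z = a * ev u z.
Proof. by rewrite -[a *: u]addr0 (ev_linear evE) ev0 addr0. Qed.

Lemma evD u v z : ev (u + v) z = ev u z + ev v z.
Proof. by rewrite -[u]scale1r (ev_linear evE) mul1r scale1r. Qed.

Lemma evB u v z : ev (u - v) z = ev u z - ev v z.
Proof. by rewrite evD -scaleN1r evZ mulN1r. Qed.

Lemma ev_at_continuous z : continuous (fun v => ev v z).
Proof. by move=> v; exact: ((ev_cvg evE v (nbhs_filter v)).1 (fun _ h => h) z). Qed.

(** The sets in the conclusion generate a filter that converges pointwise to [u], hence
    a filter finer than the neighbourhoods of [u]. *)
Lemma nbhs_ev (u : E) (A : set E) : nbhs u A ->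
  exists s : seq Z, exists2 d : R, 0 < d &
    forall v, {in s, forall z, `|ev u z - ev v z| < d} -> A v.
Proof.
pose F := filter_from [set p : seq Z * R | 0 < p.2]
  (fun p => [set v | {in p.1, forall z, `|ev u z - ev v z| < p.2}]).
have FF : Filter F.
  apply: filter_from_filter; first by exists ([::], 1) => /=.
  move=> [s d] [t e] /= d0 e0; exists (s ++ t, Num.min d e) => /=.
    by rewrite lt_min d0.
  move=> v /= vst; split=> z zs.
  - by have := vst z; rewrite mem_cat zs lt_min => /(_ isT)/andP[].
  - by have := vst z; rewrite mem_cat zs orbT lt_min => /(_ isT)/andP[].
have Fu : F --> u.
  apply/(ev_cvg evE) => z; apply/cvgrPdist_lt => e e0.
  by exists ([:: z], e) => //= v; apply; rewrite inE.
by move=> /Fu[[s d] /= d0 sdA]; exists s, d.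
Qed.

Lemma linear_functional_sum (phi : E -> R) (I : Type) (s : seq I) (c : I -> R) (e : I -> E) :
  (forall a u v, phi (a *: u + v) = a * phi u + phi v) ->
  phi (\sum_(i <- s) c i *: e i) = \sum_(i <- s) c i * phi (e i).
Proof.
move=> lphi; elim: s => [|i s IH]; last by rewrite !big_cons lphi IH.
rewrite !big_nil; have := lphi 1 0 0; rewrite scaler0 addr0 mul1r => /eqP.
by rewrite -subr_eq0 opprD addrA subrr sub0r oppr_eq0 => /eqP.
Qed.

Hypothesis sepZ : separates_points R Z.

(** By continuity, [phi] is bounded on a neighbourhood given by a finite set [s], so it
    vanishes on the functions that vanish on [s]; the weight of a point of [s] is the
    value of [phi] at a bump that isolates it in [s]. *)
Lemma dual_fsmeasure (phi : E -> R) :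
  (forall a u v, phi (a *: u + v) = a * phi u + phi v) -> continuous phi ->
  exists m : fsmeasure R Z, forall v, phi v = integral_fs m (ev v).
Proof.
move=> lphi cphi.
have phi0 : phi 0 = 0.
  by have := linear_functional_sum [::] (fun _ : nat => 0) (fun=> 0) lphi; rewrite !big_nil.
have phiZ a v : phi (a *: v) = a * phi v.
  by rewrite -[a *: v]addr0 lphi phi0 addr0.
have [s [d d0 sd]] : exists s : seq Z, exists2 d : R, 0 < d &
    forall v, {in s, forall z, `|ev v z| < d} -> `|phi v| < 1.
  have /cvgrPdist_lt/(_ 1 ltr01)/nbhs_ev[s [d d0 sd]] := cphi 0.
  exists s, d => // v vs; have := sd v; rewrite phi0 sub0r normrN; apply => z zs.
  by rewrite ev0 sub0r normrN; exact: vs.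
(* a scaling that would give [phi] the value 1 stays in the neighbourhood *)
have ker v : {in s, forall z, ev v z = 0} -> phi v = 0.
  move=> v0; apply/eqP/negP => /negP phiv.
  have := sd ((phi v)^-1 *: v); rewrite phiZ mulVf// normr1 ltxx => H.
  suff: false by []; apply: H => z zs; by rewrite evZ v0// mulr0 normr0.
have /choice[e eP] : forall x, exists e : E,
    ev e x = 1 /\ {in s, forall z, z != x -> ev e z = 0}.
  move=> x; have [|h [ch hx hs]] := @bump _ _ sepZ [seq z <- s | z != x] x.
    by rewrite mem_filter eqxx.
  have [e ee] := ev_onto evE ch; exists e; rewrite ee; split=> // z zs zx.
  by rewrite hs// mem_filter zx.
exists (FSMeasure (fun z => phi (e z)) (undup_uniq s)) => v.
have := ker (v - \sum_(z <- undup s) ev v z *: e z).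
rewrite addrC -scaleN1r lphi mulN1r linear_functional_sum// => H.
have {}H : - (\sum_(z <- undup s) ev v z * phi (e z)) + phi v = 0.
  apply: H => x xs; rewrite scaleN1r addrC evB.
  rewrite (linear_functional_sum (phi := ev^~ x)); last by move=> *; exact: ev_linear.
  rewrite (bigD1_seq x)//= ?mem_undup ?undup_uniq// (eP x).1 mulr1 opprD addrA subrr.
  rewrite big_seq_cond big1 ?subr0// => z /andP[zs zx].
  by rewrite (eP z).2 ?mulr0// eq_sym.
move/eqP: H; rewrite addrC subr_eq0 => /eqP ->.
by apply: eq_bigr => z _; rewrite mulrC.
Qed.

Lemma dual_measures (phi : nat -> E -> R) :
  (forall n a u v, phi n (a *: u + v) = a * phi n u + phi n v) ->
  (forall n, continuous (phi n)) ->
  (forall v, phi n v @[n --> \oo] --> (0 : R)) ->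
  exists mu : nat -> fsmeasure R Z, weak_null mu /\
    forall n v, phi n v = integral_fs (mu n) (ev v).
Proof.
move=> lphi cphi phi0.
have /choice[mu muP] : forall n, exists m : fsmeasure R Z,
    forall v, phi n v = integral_fs m (ev v).
  by move=> n; apply: dual_fsmeasure.
exists mu; split=> // h ch; have [v <-] := ev_onto evE ch.
by under eq_fun do rewrite -muP; exact: phi0.
Qed.

(** Boundedness of [S] is what makes this set absorbing. *)
Lemma barrel_of_bounded_set (S : set Z) :
  (forall h : Z -> R, continuous h -> exists M, forall z, S z -> `|h z| <= M) ->
  barrel [set v : E | forall z, S z -> `|ev v z| <= 1].
Proof.
move=> bS; split.
- rewrite (_ : mkset _ = \bigcap_(z in S)
      ((fun v => `|ev v z|) @^-1` [set x : R | x <= 1])) //.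
  apply: closed_bigI => z _; apply: closed_comp; last exact: closed_le.
  by move=> v _; apply: cvg_norm; exact: ev_at_continuous.
- split.
    move=> u v l /[!inE]/= uS vS z Sz; rewrite /conv/= evD !evZ.
    have l0 : 0 <= l%:num by [].
    have l1 : 0 <= 1 - l%:num by rewrite subr_ge0.
    apply: le_trans (ler_normD _ _) _; rewrite !normrM.
    rewrite (ger0_norm l0) (ger0_norm l1).
    have := ler_wpM2l l0 (uS z Sz); have := ler_wpM2l l1 (vS z Sz); lra.
  move=> a u a1 uS z Sz; rewrite evZ normrM.
  by apply: le_trans (uS z Sz); rewrite ler_piMl.
- move=> u; have [M MP] := bS _ (ev_continuous evE (u:=u)).
  exists (`|M| + 1); first by rewrite ltr_wpDl.
  move=> a Ma _ ->; have a0 : 0 < `|a| by apply: lt_le_trans Ma; rewrite ltr_wpDl.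
  have aN0 : a != 0 by rewrite -normr_gt0.
  exists (a^-1 *: u) => [z Sz|]; last by rewrite scalerA divff// scale1r.
  rewrite evZ normrM normfV ler_pdivrMl// mulr1.
  apply: le_trans (MP z Sz) _; apply: le_trans (ler_norm _) _.
  by apply: le_trans Ma; rewrite lerDl.
Qed.

(** A barrel-bounded set is uniformly bounded on the union of the supports, since that
    union is a bounded set. Were the norms to tend to 0, the functionals would thus
    tend to 0 uniformly on it. *)
Lemma JN_sequence_of_JNP : JNP E -> exists mu : nat -> fsmeasure R Z, JN_sequence mu.
Proof.
move=> /JNPP[u [/weak_star_cvgP u0 nu0]].
have linu n a v w : \val (u n) (a *: v + w) = a * \val (u n) v + \val (u n) w.
  by have := valP (u n); rewrite inE => -[+ _]; exact.
have cu n : continuous (\val (u n)).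
  by have := valP (u n); rewrite inE => -[].
have [mu [mu0 muP]] := dual_measures linu cu u0.
apply: (JN_sequence_of_norm mu0) => mass0; apply: nu0.
apply/beta_star_cvgP => B bB e e0.
pose S := [set z | exists n, z \in supp (mu n) /\ wt (mu n) z != 0].
have /bB[r r0 /(_ r)] : barrel [set v : E | forall z, S z -> `|ev v z| <= 1].
  apply: barrel_of_bounded_set => h ch.
  have [M MP] := weak_null_bounded_support sepZ mu0 ch.
  by exists M => z [n [zn wz]]; exact: MP wz.
rewrite ger0_norm ?(ltW r0)// => /(_ (lexx _)) Br.
have /cvgrPdist_lt/(_ _ (divr_gt0 e0 r0)) := mass0.
apply: filterS => n; rewrite sub0r normrN ger0_norm ?mass_ge0// => small v /Br[w wS <-].
rewrite [X in `|X|](_ : _ = - \val (u n) (r *: w)); last exact: sub0r.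
rewrite normrN muP.
apply: (@le_lt_trans _ _ (r * mass (mu n) predT)); last by rewrite -ltr_pdivlMl// mulrC.
apply: normr_integral_fs => z zn wz; rewrite evZ normrM (gtr0_norm r0).
rewrite -[leRHS]mulr1 ler_pM2l//; apply: wS; by exists n.
Qed.

End spaces_of_continuous_functions.
(** * The unit ball is barrel-bounded *)
Section bounded_continuous_functions.
Context {R : realType} {Z : topologicalType}.

(** The intervals of centre [u k z] and radius [eta k] decrease; the limit is the
    supremum of their left ends. *)
Lemma fast_uniform_limit (u : nat -> Z -> R) (eta : nat -> R) :
  (forall k, continuous (u k)) -> (forall k, 0 <= eta k) ->
  (forall k, eta k <= k.+1%:R^-1) ->
  (forall k z, `|u k.+1 z - u k z| <= eta k - eta k.+1) ->
  exists2 h : Z -> R, continuous h & forall k z, `|h z - u k z| <= eta k.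
Proof.
move=> cu eta0 etak uS.
have lo k j z : u k z - eta k <= u (j + k)%N z - eta (j + k)%N.
  elim: j => [//|j IH]; apply: le_trans IH _; rewrite addSn.
  by have := uS (j + k)%N z; rewrite ler_norml => /andP[]; lra.
have hi k j z : u (j + k)%N z + eta (j + k)%N <= u k z + eta k.
  elim: j => [//|j IH]; apply: le_trans _ IH; rewrite addSn.
  by have := uS (j + k)%N z; rewrite ler_norml => /andP[]; lra.
have nested k j z : u j z - eta j <= u k z + eta k.
  apply: le_trans (lo j k z) _; apply: le_trans _ (hi k j z); rewrite addnC.
  by have := eta0 (j + k)%N; lra.
pose A z := range (fun k => u k z - eta k).
have A0 z : A z !=set0 by exists (u 0%N z - eta 0%N); exists 0%N.
have Aub k z : ubound (A z) (u k z + eta k) by move=> _ [j _ <-].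
have hu k z : `|sup (A z) - u k z| <= eta k.
  have h1 : u k z - eta k <= sup (A z).
    by apply: ub_le_sup; [exists (u k z + eta k); exact: Aub|exists k].
  have h2 : sup (A z) <= u k z + eta k by apply: ge_sup.
  by rewrite ler_norml; apply/andP; split; lra.
exists (fun z => sup (A z)) => //.
apply: continuous_of_uniform_approximation => e e0.
exists (u (Num.truncn e^-1)) => // z; apply: le_trans (hu _ _) _.
apply: le_trans (etak _) _; rewrite -[leRHS]invrK lef_pV2 ?posrE ?invr_gt0//.
exact: ltW (truncnS_gt _).
Qed.

Context {E : tvsType R} {ev : E -> Z -> R}.
Hypothesis evE : models_Cp ev.

(** One step of the category argument. As [A] does not absorb the unit ball, some small
    multiple [c *: f] is outside [A]; by convexity, [u + (eta / 2) *: f] and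
    [u - (eta / 2) *: f] cannot both lie in the [n.+1]-fold dilation of [A]. As [A] is
    closed, a whole uniform ball around the new point avoids that dilation. *)
Lemma leave_barrel (A : set E) (u : E) (eta : R) (n : nat) : barrel A ->
  ~ absorbs A [set v : E | forall z, `|ev v z| <= 1] -> 0 < eta ->
  exists p : E * R, [/\ 0 < p.2, p.2 <= eta / 2,
    forall z, `|ev p.1 z - ev u z| <= eta / 2 &
    forall v, (forall z, `|ev p.1 z - ev v z| <= p.2) -> ~ A (n.+1%:R^-1 *: v)].
Proof.
move=> [clA [cvxA balA] _] nabs eta0.
pose c := n.+1%:R^-1 * (eta / 2).
have n0 : 0 < n.+1%:R^-1 :> R by rewrite invr_gt0.
have c0 : 0 < c by rewrite mulr_gt0// divr_gt0.
have [f f1 fA] : exists2 f, (forall z, `|ev f z| <= 1) & ~ A (c *: f).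
  apply: contrapT => H; apply: nabs; exists c^-1; first by rewrite invr_gt0.
  move=> a ca f /= f1; have a0 : 0 < `|a|.
    by apply: lt_le_trans ca; rewrite invr_gt0.
  have aN0 : a != 0 by rewrite -normr_gt0.
  exists (a^-1 *: f); last by rewrite scalerA divff// scale1r.
  have -> : a^-1 *: f = (a^-1 * c^-1) *: (c *: f).
    by rewrite scalerA -mulrA mulVf ?mulr1// gt_eqF.
  apply: balA; last by apply: contrapT => cf; apply: H; exists f.
  rewrite normrM normfV ler_pdivrMl// mulr1 gtr0_norm ?invr_gt0//.
have [s [s1 us]] : exists s : R, `|s| = 1 /\
    ~ A (n.+1%:R^-1 *: (u + (s * (eta / 2)) *: f)).
  apply: contrapT => H; apply: fA.
  have HA s : `|s| = 1 -> A (n.+1%:R^-1 *: (u + (s * (eta / 2)) *: f)).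
    by move=> s1; apply: contrapT => sA; apply: H; exists s.
  have A1 := HA 1 (normr1 _).
  have A2 : A ((-1) *: (n.+1%:R^-1 *: (u + ((-1) * (eta / 2)) *: f))).
    by apply: balA; [rewrite normrN normr1|apply: HA; rewrite normrN normr1].
  have h0 : 0 <= 1 / 2 :> R by rewrite divr_ge0.
  have h1 : 1 / 2 <= 1 :> R by lra.
  have /set_mem := cvxA _ _ (Itv01 h0 h1) (mem_set A1) (mem_set A2).
  rewrite /conv/= (_ : _ + _ = c *: f)//.
  rewrite !scalerDr !scalerA addrACA -!scalerDl /unstable.onem /c.
  rewrite (_ : 1 / 2 + (1 - 1 / 2) * -1 = 0) ?scale0r ?add0r; last by field.
  by congr (_ *: _); field.
set p := n.+1%:R^-1 *: _ in us.
have /(nbhs_ev evE)[t [d d0 td]] : nbhs p (~` A).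
  by apply: open_nbhs_nbhs; split=> //; exact: closed_openC.
have d'0 : 0 < n.+1%:R * (d / 2) by rewrite mulr_gt0// divr_gt0.
exists (u + (s * (eta / 2)) *: f, Num.min (eta / 2) (n.+1%:R * (d / 2))); split=> /=.
- by rewrite lt_min d'0 divr_gt0.
- by rewrite ge_min lexx.
- move=> z; rewrite evD// evZ// addrAC subrr add0r !normrM s1 mul1r.
  by rewrite -normrM gtr0_norm ?divr_gt0// ler_piMr// divr_ge0// ltW.
- move=> v vd; apply: td => z zt.
  rewrite /p !(evZ evE) -mulrBr normrM gtr0_norm// -ltr_pdivlMl// invrK.
  have := vd z; rewrite le_min => /andP[_ vz]; apply: le_lt_trans vz _.
  by rewrite ltr_pM2l//; lra.
Qed.

(** Otherwise [leave_barrel] produces a uniformly convergent sequence whose limit lies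
    in no dilation of the barrel, although barrels are absorbing. *)
Lemma unit_ball_barrel_bounded :
  barrel_bounded [set v : E | forall z, `|ev v z| <= 1].
Proof.
move=> A bA; apply: contrapT => nabs.
have /choice[next nextP] : forall q : E * R * nat, exists p : E * R, 0 < q.1.2 ->
    [/\ 0 < p.2, p.2 <= q.1.2 / 2,
    forall z, `|ev p.1 z - ev q.1.1 z| <= q.1.2 / 2 &
    forall v, (forall z, `|ev p.1 z - ev v z| <= p.2) -> ~ A (q.2.+1%:R^-1 *: v)].
  move=> [[u eta] n] /=; have [eta0|_] := ltP 0 eta; last by exists (u, eta).
  by have [p pP] := leave_barrel u n bA nabs eta0; exists p.
pose fix w k := if k is k'.+1 then next (w k', k') else (0, 1).
have w0 k : 0 < (w k).2.
  by elim: k => [//|k IH]; have [] := nextP (w k, k) IH.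
have w2 k : (w k.+1).2 <= (w k).2 / 2 by have [] := nextP (w k, k) (w0 k).
have [|||k z|h ch hw] := @fast_uniform_limit (fun k => ev (w k).1) (fun k => (w k).2).
- by move=> k; exact: ev_continuous evE _.
- by move=> k; exact: ltW.
- elim=> [|k IH]; first by rewrite invr1.
  apply: le_trans (w2 k) _; rewrite ler_pdivrMr//.
  apply: le_trans IH _; rewrite [leRHS]mulrC ler_pdivlMr// [leLHS]mulrC ler_pdivrMr//.
  by rewrite -!natr1; have : 0 <= k%:R :> R by []; lra.
- have [_ _ + _] := nextP (w k, k) (w0 k); move=> /(_ z) /= wz.
  by apply: le_trans wz _; have := w2 k; lra.
have [v vh] := ev_onto evE ch.
have nA k : ~ A (k.+1%:R^-1 *: v).
  have [_ _ _ /= H] := nextP (w k, k) (w0 k); apply: H => z.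
  by rewrite vh distrC; exact: (hw k.+1 z).
have [_ _ /(_ v)[r r0 rA]] := bA.
pose k := Num.truncn r.
have rk : r <= `|k.+1%:R : R| by rewrite normr_nat; exact: ltW (truncnS_gt _).
have [y Ay yv] := rA _ rk v erefl.
by apply: (nA k); rewrite -yv scalerA mulVf ?scale1r.
Qed.

Hypothesis sepZ : separates_points R Z.

Lemma JNP_of_JN_sequence (mu : nat -> fsmeasure R Z) : JN_sequence mu -> JNP E.
Proof.
move=> [mu0 mu1]; apply/JNPP.
have uP n : (fun v : E => integral_fs (mu n) (ev v) : R^o) \in @dual_pred R E.
  rewrite inE; split.
    move=> a v w; rewrite -[RHS]/(a * integral_fs (mu n) (ev v) + integral_fs (mu n) (ev w)).
    rewrite -integral_fsZ -integral_fsD; apply: eq_integral_fs => z _.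
    exact: ev_linear.
  apply: continuous_sum => z; apply: continuous_scale; exact: ev_at_continuous.
pose u n : dual E := exist (fun f => f \in @dual_pred R E) _ (uP n).
exists u; split.
  apply/weak_star_cvgP => v; exact: (mu0 _ (ev_continuous evE (u:=v))).
move=> /beta_star_cvgP/(_ _ unit_ball_barrel_bounded 1 ltr01)[N _ /(_ N (leqnn N))].
have [h [ch h1 hs]] := norming_function sepZ (mu N).
have [v vh] := ev_onto evE ch => /(_ v); rewrite /= vh => /(_ h1).
rewrite [X in `|X|](_ : _ = - integral_fs (mu N) h); last first.
  by rewrite -vh; exact: sub0r.
rewrite normrN (_ : integral_fs _ _ = 1) ?normr1 ?ltxx//.
rewrite -(mu1 N) /mass; apply: eq_big_seq => z zN.
by rewrite hs// mulrC -normrEsg.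
Qed.

End bounded_continuous_functions.
(** * Functions with disjoint supports adapted to a Josefson-Nissenzweig sequence *)
Section disjoint_functions.
Context {R : realType} {Z : topologicalType}.
Hypothesis sepZ : separates_points R Z.
Implicit Types mu : nat -> fsmeasure R Z.

(** Points in no support before the [k]-th. *)
Definition new_points mu k : pred Z := fun z =>
  all (fun j => z \notin supp (mu j)) (iota 0 k).

Lemma spread_subsequence mu : JN_sequence mu ->
  exists2 nu, JN_sequence nu & forall k, 1 / 3 <= mass (nu k) (new_points nu k).
Proof.
move=> JNmu; have [mu0 mu1] := JNmu.
pose old p := flatten [seq supp (mu q) | q <- iota 0 p.+1].
have [|f fS fP] := @diagonal_subsequence
    (fun p i => 1 / 3 <= mass (mu i) [pred z | z \notin old p]).
  by move=> p; exact: mass_escapes.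
exists (mu \o f); first split.
- by apply: weak_null_subseq => //; exact: strictly_increasing_ge.
- by move=> n; exact: mu1.
case=> [|k].
  apply: (@le_trans _ _ (mass (mu (f 0)) predT)); first by rewrite mu1; lra.
  exact: mass_sub.
apply: le_trans (fP k k.+1 (ltnSn k)) _; apply: mass_sub => z /= zold.
apply/allP => j; rewrite mem_iota/= add0n ltnS => jk; apply: contra zold => zj.
apply/flattenP; exists (supp (mu (f j))) => //; apply/mapP; exists (f j) => //.
rewrite mem_iota/= add0n ltnS; move: jk; rewrite leq_eqVlt => /predU1P[->//|jk].
exact: ltnW (strictly_increasing_mono fS jk).
Qed.

(** For [k] in a long finite part [s] of [N], the tents around the new points of the
    [mu k] have disjoint supports, obtained from one function that takes the value [k]
    at the new points of [mu k]. Each measure of norm 1 gives mass at most [d] to one of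
    these tents, so a single tent works for infinitely many measures. *)
Lemma pigeonhole_tent mu (N : set nat) (m : nat) (d : R) :
  (forall n, mass (mu n) predT = 1) -> unbounded N -> 0 < d ->
  exists k, exists N' : set nat, exists phi : Z -> R, [/\ [/\ N k, (m <= k)%N,
      unbounded N' & N' `<=` N],
    [/\ continuous phi, forall z, 0 <= phi z <= 1,
      forall z, z \in supp (mu k) -> new_points mu k z -> phi z = 1 &
      forall j z, (j < k)%N -> z \in supp (mu j) -> phi z = 0] &
    forall n, N' n -> mass (mu n) [pred z | phi z != 0] <= d].
Proof.
move=> mu1 uN d0; pose M := (Num.truncn d^-1).+1.
have [s [us ss sN]] := unbounded_seq M m uN.
pose K := (\sum_(k <- s) k).+1.
have sK k : k \in s -> (k < K)%N.
  by move=> ks; rewrite ltnS (bigD1_seq k)//= leq_addr.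
(* the first support that contains [z]: it is [k] exactly at the new points of [mu k] *)
pose lev z := find (fun k => z \in supp (mu k)) (iota 0 K).
have [g cg gF] := interpolation sepZ (flatten [seq supp (mu q) | q <- iota 0 K])
  (fun z => (lev z)%:R).
have {}gF k z : (k < K)%N -> z \in supp (mu k) -> g z = (lev z)%:R.
  move=> kK zk; apply: gF; apply/flattenP; exists (supp (mu k)) => //.
  by apply/mapP; exists k; rewrite // mem_iota.
have levle k z : (k < K)%N -> z \in supp (mu k) -> (lev z <= k)%N.
  move=> kK zk; rewrite leqNgt; apply/negP => /(before_find 0%N).
  by rewrite nth_iota// add0n zk.
have levnew k z : (k < K)%N -> z \in supp (mu k) -> new_points mu k z -> lev z = k.
  move=> kK zk /allP newz; apply/eqP; rewrite eqn_leq levle//= leqNgt.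
  apply/negP => lk; have := newz (lev z); rewrite mem_iota/= add0n lk => /(_ isT).
  apply/negP/negPn; have /(nth_find 0%N) : has (fun k => z \in supp (mu k)) (iota 0 K).
    by apply/hasP; exists k; rewrite // mem_iota.
  by rewrite nth_iota ?add0n// (leq_ltn_trans _ kK)// ltnW.
pose phi (k : nat) z := tent (g z - k%:R).
have [k [ks uk]] : exists k, k \in s /\
    unbounded [set n | N n /\ mass (mu n) [pred z | phi k z != 0] <= d].
  apply: contrapT => H.
  have /choice[b bP] : forall k, exists b, k \in s -> forall n, (b <= n)%N -> N n ->
      d < mass (mu n) [pred z | phi k z != 0].
    move=> k; apply: contrapT => Hk; apply: H; exists k; split.
      by apply: contrapT => ks; apply: Hk; exists 0%N => /ks.
    move=> b; apply: contrapT => Hb; apply: Hk; exists b => _ n bn Nn.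
    by rewrite ltNge; apply/negP => nd; apply: Hb; exists n.
  have [n bn Nn] := uN (\sum_(k <- s) b k)%N.
  have small : \sum_(k <- s) mass (mu n) [pred z | phi k z != 0] <= 1.
    rewrite -(mu1 n) /mass; under eq_bigr do rewrite big_mkcond/=.
    rewrite exchange_big/=; apply: ler_sum => z _.
    rewrite (eq_bigr (fun k => `|wt (mu n) z| * (phi k z != 0)%:R)); last first.
      by move=> k _; case: ifP => _; rewrite ?mulr1 ?mulr0.
    by rewrite -big_distrr/= ler_piMr//; exact: sum_tent_support.
  have big : M%:R * d <= \sum_(k <- s) mass (mu n) [pred z | phi k z != 0].
    rewrite -ss -sum1_size natr_sum big_distrl/= big_seq [leRHS]big_seq.
    apply: ler_sum => k ks; rewrite mul1r; apply: ltW; apply: (bP k ks) => //.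
    by apply: leq_trans bn; rewrite (bigD1_seq k)//= leq_addr.
  have : 1 < M%:R * d by rewrite -ltr_pdivrMr// div1r; exact: truncnS_gt.
  by apply/negP; rewrite -leNgt; exact: le_trans big small.
have [Nk mk] := sN _ ks.
exists k, [set n | N n /\ mass (mu n) [pred z | phi k z != 0] <= d], (phi k); split.
- by split=> // n [].
- split.
  + apply: continuous_tent; apply: continuous_sub => //; exact: continuous_const.
  + by move=> z; rewrite tent_ge0 tent_le1.
  + move=> z zk newz; rewrite /phi (gF k)// ?sK// (levnew k)// ?sK//.
    by rewrite subrr tent0.
  + move=> j z jk zj; have jK := ltn_trans jk (sK _ ks).
    have lk : (lev z < k)%N by exact: leq_ltn_trans (levle _ _ jK zj) jk.
    apply: (@tent_disjoint _ _ (lev z)); first by rewrite ltn_eqF.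
    by rewrite (gF j)// subrr tent0 oner_eq0.
- by move=> n [].
Qed.

(** The state of the recursion is the set of indices still available, a lower bound for
    the next index, and the number of steps done. *)
Lemma nearly_disjoint_tents mu (d : nat -> R) :
  (forall n, mass (mu n) predT = 1) -> (forall j, 0 < d j) ->
  exists (k : nat -> nat) (phi : nat -> Z -> R), [/\ forall j, (k j < k j.+1)%N,
    forall j, continuous (phi j) /\ forall z, 0 <= phi j z <= 1,
    forall j z, z \in supp (mu (k j)) -> new_points mu (k j) z -> phi j z = 1,
    forall i j z, (i < j)%N -> z \in supp (mu (k i)) -> phi j z = 0 &
    forall i j, (i < j)%N -> mass (mu (k j)) [pred z | phi i z != 0] <= d i].
Proof.
move=> mu1 d0.
have /choice[next nextP] : forall q : set nat * nat * nat,
    exists p : set nat * nat * (Z -> R), unbounded q.1.1 ->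
    [/\ [/\ q.1.1 p.1.2, (q.1.2 <= p.1.2)%N, unbounded p.1.1 & p.1.1 `<=` q.1.1],
    [/\ continuous p.2, forall z, 0 <= p.2 z <= 1,
      forall z, z \in supp (mu p.1.2) -> new_points mu p.1.2 z -> p.2 z = 1 &
      forall j z, (j < p.1.2)%N -> z \in supp (mu j) -> p.2 z = 0] &
    forall n, p.1.1 n -> mass (mu n) [pred z | p.2 z != 0] <= d q.2].
  move=> [[N m] j] /=; have [uN|nuN] := pselect (unbounded N); last first.
    by exists (N, m, fun=> 0) => /nuN.
  have [k [N' [phi H]]] := pigeonhole_tent m mu1 uN (d0 j).
  by exists (N', k, phi).
pose fix st j : set nat * nat * nat := if j is j'.+1 then
    let p := next (st j') in (p.1.1, p.1.2.+1, j'.+1) else (setT, 0%N, 0%N).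
have stu j : unbounded (st j).1.1.
  elim: j => [|j IH]; first by move=> m; exists m.
  by have [[]] := nextP (st j) IH.
have st2 j : (st j).2 = j by case: j.
have nP j := nextP (st j) (stu j).
pose k j := (next (st j)).1.2; pose phi j := (next (st j)).2.
have kS j : (k j < k j.+1)%N by have [[_ + _ _] _ _] := nP j.+1; apply: leq_trans.
have stsub i j : (i <= j)%N -> (st j).1.1 `<=` (st i).1.1.
  move=> /subnK <-; elim: (j - i)%N => [//|l IH]; rewrite addSn => x stx.
  by apply: IH; have [[_ _ _ sub] _ _] := nP (l + i)%N; exact: sub.
have kmono := strictly_increasing_mono kS.
exists k, phi; split => //.
- by move=> j; have [_ [? ? _ _] _] := nP j.
- by move=> j; have [_ [_ _ ? _] _] := nP j.
- by move=> i j z ij; have [_ [_ _ _ +] _] := nP j; apply; exact: kmono.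
- move=> i j ij; have [_ _] := nP i; rewrite st2; apply.
  by have [[+ _ _ _] _ _] := nP j; apply: (stsub i.+1).
Qed.

(** The truncations [max 0 (2 * phi i - 1)] and [max 0 (1 - 2 * phi i)] of the same
    function have disjoint supports; the former is a factor of [g i], the latter a
    factor of [g j] for all [j > i]. *)
Lemma disjointify (phi : nat -> Z -> R) :
  (forall j, continuous (phi j) /\ forall z, 0 <= phi j z <= 1) ->
  exists g : nat -> Z -> R, [/\ forall j, continuous (g j),
    forall j z, 0 <= g j z <= 1,
    forall i j z, g i z != 0 -> g j z != 0 -> i = j,
    forall j z, phi j z = 0 -> g j z = 0 &
    forall j z, phi j z = 1 -> (forall i, (i < j)%N -> phi i z = 0) -> g j z = 1].
Proof.
move=> phiP.
pose g j z := \prod_(i < j) Num.max 0 (1 - 2 * phi i z) * Num.max 0 (2 * phi j z - 1).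
have fac01 i z : 0 <= Num.max 0 (1 - 2 * phi i z) <= 1.
  rewrite le_max lexx/= ge_max ler01/= gerBl.
  by have [_ /(_ z)/andP[? _]] := phiP i; rewrite mulr_ge0.
have gdisj i j z : (i < j)%N -> g i z != 0 -> g j z = 0.
  move=> ij; rewrite /g mulf_eq0 negb_or => /andP[_].
  have [h|h] := leP (2 * phi i z - 1) 0; first by rewrite eqxx.
  move=> _; rewrite (bigD1 (Ordinal ij))//= (_ : Num.max 0 _ = 0) ?mul0r//.
  by rewrite max_l//; lra.
exists g; split.
- move=> j; apply: continuous_mul.
    apply: continuous_prod => i; apply: continuous_maxr; first exact: continuous_const.
    apply: continuous_sub; first exact: continuous_const.
    by apply: continuous_scale; have [] := phiP i.
  apply: continuous_maxr; first exact: continuous_const.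
  apply: continuous_sub; last exact: continuous_const.
  by apply: continuous_scale; have [] := phiP j.
- move=> j z; have prod0 : 0 <= \prod_(i < j) Num.max 0 (1 - 2 * phi i z).
    by apply: prodr_ge0 => i _; have /andP[] := fac01 i z.
  rewrite mulr_ge0 ?le_max ?lexx//= mulr_ile1 ?le_max ?lexx//.
  + by apply: prodr_ile1 => i _; exact: fac01.
  + by rewrite ge_max ler01/=; have [_ /(_ z)/andP[_ ?]] := phiP j; lra.
- move=> i j z gi gj; apply/eqP.
  case: (ltngtP i j) => // [/gdisj/(_ gi) e|/gdisj/(_ gj) e].
    by rewrite e eqxx in gj.
  by rewrite e eqxx in gi.
- move=> j z phij; rewrite /g phij mulr0 sub0r.
  by rewrite (max_l (_ : - 1 <= 0))// !mulr0.
- move=> j z phij phii; rewrite /g phij big1 => [|i _].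
    have -> : 2 * 1 - 1 = 1 :> R by ring.
    by rewrite max_r ?mulr1.
  by rewrite phii// mulr0 subr0 max_r.
Qed.

(** At least 1/3 of the mass of a measure sits at new points, and the earlier tents
    remove at most 1/6 in total, thanks to the summable tolerances [d]. *)
Lemma disjoint_norming_functions mu : JN_sequence mu ->
  exists (nu : nat -> fsmeasure R Z) (f : nat -> Z -> R), weak_null nu /\
    [/\ forall j, continuous (f j), forall j z, `|f j z| <= 1,
      forall i j z, f i z != 0 -> f j z != 0 -> i = j,
      forall i j z, (i < j)%N -> z \in supp (nu i) -> f j z = 0 &
      forall j, 1 / 6 <= integral_fs (nu j) (f j)].
Proof.
move=> /spread_subsequence[lam [lam0 lam1] lamnew].
pose d (j : nat) : R := 1 / 6 / 2 ^+ j.+1.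
have d0 j : 0 < d j by rewrite !divr_gt0// exprn_gt0.
have sumd j : \sum_(i < j) d i <= 1 / 6.
  suff -> : \sum_(i < j) d i = 1 / 6 - 1 / 6 / 2 ^+ j.
    by rewrite gerBl !divr_ge0// exprn_ge0.
  elim: j => [|j IH]; first by rewrite big_ord0 expr0 divr1 subrr.
  rewrite big_ord_recr/= IH /d exprS; field.
  by rewrite expf_neq0.
have [k [phi [kS phiP phi1 phi0 phid]]] := nearly_disjoint_tents lam1 d0.
have /choice[sg sgP] := fun j => norming_function sepZ (lam (k j)).
have [g [cg g01 gdisj gphi0 gphi1]] := disjointify phiP.
exists (fun j => lam (k j)), (fun j z => sg j z * g j z); split.
  exact: (weak_null_subseq (strictly_increasing_ge kS) lam0).
split.
- by move=> j; apply: continuous_mul => //; have [] := sgP j.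
- move=> j z; have /andP[g0 g1] := g01 j z.
  rewrite normrM (ger0_norm g0) mulr_ile1//.
  by have [_ + _] := sgP j; exact.
- move=> i j z.
  have gN l : sg l z * g l z != 0 -> g l z != 0.
    by apply: contraNneq => ->; rewrite mulr0.
  by move=> /gN gi /gN gj; exact: gdisj gi gj.
- by move=> i j z ij zi; rewrite gphi0 ?mulr0//; exact: phi0 ij zi.
move=> j.
have int_ge : mass (lam (k j)) (fun z => new_points lam (k j) z &&
      [forall i : 'I_j, phi i z == 0]) <=
    integral_fs (lam (k j)) (fun z => sg j z * g j z).
  rewrite /mass big_mkcond; rewrite /integral_fs big_seq [leRHS]big_seq.
  apply: ler_sum => z zk; have [_ _ sgz] := sgP j.
  rewrite sgz// mulrA [_ * Num.sg _]mulrC -normrEsg.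
  case: ifP => [/andP[newz /forallP all0]|_].
    rewrite gphi1 ?mulr1//; first exact: phi1.
    by move=> i ij; apply/eqP; exact: all0 (Ordinal ij).
  by rewrite mulr_ge0//; have /andP[] := g01 j z.
apply: le_trans int_ge.
(* a new point either avoids the earlier tents or is counted in one of them *)
have cover : mass (lam (k j)) (new_points lam (k j)) <=
    mass (lam (k j)) (fun z => new_points lam (k j) z && [forall i : 'I_j, phi i z == 0])
    + \sum_(i < j) mass (lam (k j)) [pred z | phi i z != 0].
  rewrite /mass; under [X in _ <= _ + X]eq_bigr do rewrite big_mkcond/=.
  rewrite exchange_big/= [leLHS]big_mkcond [X in _ <= X + _]big_mkcond/=.
  rewrite -big_split/=.
  apply: ler_sum => z _; case: ifP => _ /=; last first.
    by rewrite add0r sumr_ge0// => i _; case: ifP.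
  case: forallP => [_|/forallP]; first by rewrite lerDl sumr_ge0// => i _; case: ifP.
  rewrite negb_forall => /existsP[i phii]; rewrite add0r (bigD1 i)//= phii lerDl.
  by rewrite sumr_ge0// => l _; case: ifP.
have : \sum_(i < j) mass (lam (k j)) [pred z | phi i z != 0] <= 1 / 6.
  by apply: le_trans (sumd j); apply: ler_sum => i _; exact: phid.
have := lamnew (k j); lra.
Qed.

(** Apply the construction to the Dirac measures at the points [x n]: a tent of mass at
    most 1/2 for a Dirac measure vanishes at its point. *)
Lemma disjoint_bumps (x : nat -> Z) : (forall i j, (i < j)%N -> x j != x i) ->
  exists (k : nat -> nat) (g : nat -> Z -> R), [/\ forall j, (k j < k j.+1)%N,
    forall j, continuous (g j),
    forall i j z, g i z != 0 -> g j z != 0 -> i = j &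
    forall j, g j (x (k j)) = 1].
Proof.
move=> xinj.
pose dirac n := @FSMeasure R Z [:: x n] (fun=> 1) isT.
have dirac1 n : mass (dirac n) predT = 1 by rewrite /mass big_seq1 normr1.
have [k [phi [kS phiP phi1 phi0 phid]]] :=
  @nearly_disjoint_tents dirac (fun=> 1 / 2) dirac1 (fun=> divr_gt0 ltr01 (ltr0Sn _ _)).
have [g [cg _ gdisj _ gphi1]] := disjointify phiP.
exists k, g; split=> // j; apply: gphi1.
  apply: phi1; first by rewrite inE.
  by apply/allP => i; rewrite mem_iota/= add0n inE => /xinj.
move=> i ij; apply/eqP; apply: contraT => phin0.
have := phid _ _ ij; rewrite /mass big_mkcond big_seq1/= phin0 normr1; lra.
Qed.

(** The entries below the diagonal tend to 0 in each column, as [lam] is weakly null, so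
    a sparse subsequence makes them as small as needed. The square makes the sum of the
    [j] entries of row [j] at most 1/2 and of order 1/j. *)
Lemma biorthogonal_system mu : JN_sequence mu ->
  exists (nu : nat -> fsmeasure R Z) (f : nat -> Z -> R), weak_null nu /\
    [/\ forall j, continuous (f j) /\ forall z, `|f j z| <= 6,
      forall i j z, f i z != 0 -> f j z != 0 -> i = j,
      forall i j z, (i < j)%N -> z \in supp (nu i) -> f j z = 0,
      forall j, integral_fs (nu j) (f j) = 1 &
      forall i j, (i < j)%N -> `|integral_fs (nu j) (f i)| <= j.+1%:R^-1 ^+ 2].
Proof.
move=> /disjoint_norming_functions[lam [f [lam0 [cf f1 fdisj f0 int_f]]]].
have int_gt0 j : 0 < integral_fs (lam j) (f j).
  by apply: lt_le_trans (int_f j); rewrite divr_gt0.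
pose h j z := (integral_fs (lam j) (f j))^-1 * f j z.
have ch j : continuous (h j) by exact: continuous_scale.
have hf i z : (h i z != 0) = (f i z != 0).
  by rewrite /h mulf_eq0 invr_eq0 gt_eqF.
(* [p.+2] rather than [p.+1]: row [j.+1] is controlled through [p = k j >= j] *)
have [|k kS kP] := @diagonal_subsequence (fun p i => forall l, (l <= p)%N ->
    `|integral_fs (lam i) (h l)| <= p.+2%:R^-1 ^+ 2).
  move=> p; have e0 : 0 < p.+2%:R^-1 ^+ 2 :> R by rewrite exprn_gt0// invr_gt0.
  have [N _ NP] : \forall i \near \oo, \sum_(l < p.+1) `|integral_fs (lam i) (h l)| <= p.+2%:R^-1 ^+ 2.
    have : \sum_(l < p.+1) `|integral_fs (lam i) (h l)| @[i --> \oo] --> (0 : R).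
      apply: cvg_sum0 => l; have := cvg_norm (lam0 _ (ch l)); rewrite normr0; exact.
    move=> /cvgr0Pnorm_le/(_ _ e0); apply: filterS => i.
    by rewrite ger0_norm// sumr_ge0.
  exists N => // i /NP iP l lp; apply: le_trans iP.
  by rewrite (bigD1 (Ordinal (lp : (l < p.+1)%N)))//= lerDl sumr_ge0.
have kmono := strictly_increasing_mono kS.
have kinj := strictly_increasing_inj kS.
exists (lam \o k), (fun j => h (k j)); split.
  exact: (weak_null_subseq (strictly_increasing_ge kS) lam0).
split.
- move=> j; split=> // z; rewrite normrM normfV (gtr0_norm (int_gt0 _)) ler_pdivrMl//.
  by apply: le_trans (f1 _ z) _; have := int_f (k j); lra.
- by move=> i j z; rewrite !hf => fi fj; apply: kinj; exact: fdisj fi fj.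
- by move=> i j z ij zi; rewrite /h (f0 _ _ _ (kmono _ _ ij) zi) mulr0.
- by move=> j; rewrite integral_fsZ mulVf// gt_eqF.
- move=> i [//|j]; rewrite ltnS => ij.
  have kij : (k i <= k j)%N.
    by move: ij; rewrite leq_eqVlt => /predU1P[->//|/kmono/ltnW].
  apply: le_trans (kP _ _ (ltnSn j) _ kij) _.
  rewrite lerXn2r ?nnegrE ?invr_ge0// lef_pV2 ?posrE// ler_nat !ltnS.
  exact: strictly_increasing_ge.
Qed.

End disjoint_functions.
(** * Complemented copies of the space of null sequences *)
Section null_sequences.
Context {R : realType}.

Lemma c0p_coord_continuous (n : nat) : continuous (fun x : c0p R => \val x n).
Proof.
move=> x; exact: ((ptws_cvgP (\val x) _).1
  ((initial_cvgP x (nbhs_filter x)).1 (fun _ h => h)) n).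
Qed.

Lemma continuous_c0p (T : topologicalType) (g : T -> c0p R) :
  (forall n, continuous (fun t => \val (g t) n)) -> continuous g.
Proof. by move=> cg t; apply/initial_cvgP/ptws_cvgP => n; exact: cg. Qed.

Lemma c0p_cvg0 (x : c0p R) : \val x n @[n --> \oo] --> (0 : R).
Proof. by have := valP x; rewrite inE. Qed.

Lemma c0p_mk (x : nat -> R) : x @ \oo --> (0 : R) ->
  exists y : c0p R, \val y = x.
Proof.
move=> x0; have xP : (x : nat -> R^o) \in @c0p_pred R by rewrite inE.
by exists (exist (fun x => x \in @c0p_pred R) _ xP).
Qed.

End null_sequences.

Section complemented_copies.
Context {R : realType}.

Lemma surjection_of_complemented_copy (E F : tvsType R) :
  contains_complemented_copy E F -> continuous_linear_surjection_onto E F.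
Proof.
move=> [E1 [E2 [_ _ [[E10 E1S] [E20 E2S] _ E12] [g [cg gE1 [h [gh ch]]]]
  [P [PE cP]]]]].
have E1P u : E1 (P u).
  have [v E1v [w E2w <-]] : [set u + v | u in E1 & v in E2] u by rewrite E12.
  by rewrite PE.
have E2_0 : E2 0 by have := E20; rewrite inE.
have Plin : linear P.
  move=> a u u'.
  have [v E1v [w E2w <-]] : [set u + v | u in E1 & v in E2] u by rewrite E12.
  have [v' E1v' [w' E2w' <-]] : [set u + v | u in E1 & v in E2] u' by rewrite E12.
  rewrite scalerDr addrACA !PE//.
  - by have := E1S a v v'; rewrite !inE; apply.
  - by have := E2S a w w'; rewrite !inE; apply.
have hlin : linear (h \o P).
  move=> a u u' /=; rewrite Plin.
  have [x _ <-] : range g (P u) by rewrite gE1.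
  have [y _ <-] : range g (P u') by rewrite gE1.
  by rewrite -linearP !gh.
pose T : {linear E -> F} := HB.pack (h \o P) (GRing.isLinear.Build R E F *:%R (h \o P) hlin).
exists T; split.
  move=> u; have /subspace_continuousP/(_ (P u) (E1P u)) hP := ch.
  move=> A /hP wA.
  have : nbhs u (P @^-1` [set v | E1 v -> A (h v)]) by exact: cP.
  by apply: filterS => v /=; apply; exact: E1P.
apply/seteqP; split=> // x _; exists (g x) => //=.
by rewrite -[g x]addr0 PE// -?gE1 ?gh//; exists x.
Qed.

Context {Z : topologicalType} {E : tvsType R} {ev : E -> Z -> R}.
Hypothesis evE : models_Cp ev.
Hypothesis sepZ : separates_points R Z.

(** If the coordinate functionals had norms tending to 0, the null sequence [x], with
    [x n ^+ 2] larger than the [n]-th norm, would have a preimage [v]. But the [n]-th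
    coordinate of [v] is at most a constant times the norm, hence at most
    [M * x n ^+ 2], which is less than [x n] eventually. *)
Lemma JN_sequence_of_surjection :
  continuous_linear_surjection_onto E (c0p R) ->
  exists mu : nat -> fsmeasure R Z, JN_sequence mu.
Proof.
move=> [T [cT rT]].
have [|||mu [mu0 muP]] := dual_measures evE sepZ (phi := fun n v => \val (T v) n).
- by move=> n a u v; rewrite linearP.
- move=> n v.
  exact: (cvg_comp _ _ (cT v) (@c0p_coord_continuous R n (T v))).
- by move=> v; exact: c0p_cvg0.
apply: (JN_sequence_of_norm mu0) => mass0.
pose x n : R := Num.sqrt (mass (mu n) predT + n.+1%:R^-1).
have x2 n : x n ^+ 2 = mass (mu n) predT + n.+1%:R^-1.
  by rewrite sqr_sqrtr// addr_ge0// ?mass_ge0// invr_ge0.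
have xpos n : 0 < x n.
  by rewrite sqrtr_gt0 ltr_wpDl ?mass_ge0// invr_gt0.
have x0 : x @ \oo --> (0 : R).
  rewrite -[X in _ --> X]sqrtr0.
  apply: (cvg_comp (fun n => mass (mu n) predT + n.+1%:R^-1) Num.sqrt); last exact: sqrt_continuous.
  have := cvgD mass0 (@cvg_harmonic R); rewrite addr0; exact.
have [y yx] := c0p_mk x0.
have [v _ vy] : range T y by rewrite rT.
have [M M0 MP] := weak_null_bounded_of_norm0 sepZ mu0 (ev_continuous evE (u:=v)).
have M1 : 0 < M + 1 by rewrite ltr_wpDl.
have /cvgrPdist_lt/(_ (M + 1)^-1) := x0; case; first by rewrite invr_gt0.
move=> N _ /(_ N (leqnn N)) /=; rewrite sub0r normrN gtr0_norm// => xN.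
have : x N <= M * x N ^+ 2.
  apply: (@le_trans _ _ `|integral_fs (mu N) (ev v)|).
    by rewrite -muP vy yx ler_norm.
  by apply: le_trans (MP N) _; rewrite ler_wpM2l// x2 lerDl invr_ge0.
rewrite leNgt => /negP; apply; rewrite expr2 mulrA gtr_pMl//.
have : (M + 1) * x N < 1 by rewrite mulrC -ltr_pdivlMr// div1r.
have := xpos N; lra.
Qed.

Lemma complemented_copy_of_section (T : {linear E -> c0p R}) (S : {linear c0p R -> E}) :
  continuous T -> continuous S -> cancel S T ->
  contains_complemented_copy E (c0p R).
Proof.
move=> cT cS ST.
have cP : continuous (S \o T).
  by move=> u; exact: (cvg_comp _ _ (cT u) (cS (T u))).
have rangeS u : range S u <-> S (T u) = u.
  by split=> [[x _ <-]|<-]; [rewrite ST|exists (T u)].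
exists (range S), [set u | T u = 0]; split.
- rewrite (_ : range S = \bigcap_z
      ((fun u => ev (S (T u)) z - ev u z) @^-1` [set 0])).
    apply: closed_bigI => z _; apply: closed_comp; last exact: closed_eq.
    move=> u _; apply: (@continuous_sub _ _ (fun u => ev (S (T u)) z)) => v.
      exact: (cvg_comp _ _ (cP v) (@ev_at_continuous _ _ _ _ evE z (S (T v)))).
    exact: (@ev_at_continuous _ _ _ _ evE).
  apply/seteqP; split=> u.
    by move=> /rangeS Su z _ /=; rewrite Su subrr.
  move=> H; apply/rangeS; apply: (ev_inj evE); apply/funext => z.
  by apply/eqP; rewrite -subr_eq0; apply/eqP; exact: H.
- rewrite (_ : mkset _ = \bigcap_n ((fun u => \val (T u) n) @^-1` [set 0])).
    apply: closed_bigI => n _; apply: closed_comp; last exact: closed_eq.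
    move=> u _.
    exact: (cvg_comp _ _ (cT u) (@c0p_coord_continuous R n (T u))).
  apply/seteqP; split=> u /=; first by move=> Tu n _; rewrite /= Tu.
  by move=> H; apply: val_inj; apply/funext => n; exact: H.
- split.
  + split; first by rewrite inE; exists 0; rewrite ?linear0.
    move=> a u v /[!inE] -[x _ <-] [y _ <-]; exists (a *: x + y) => //.
    by rewrite linearP.
  + split; first by rewrite inE/= linear0.
    by move=> a u v /[!inE]/= Tu Tv; rewrite linearP Tu Tv scaler0 addr0.
  + apply/seteqP; split=> u; last by move=> ->; split; [exists 0; rewrite ?linear0|rewrite /= linear0].
    by move=> [[x _ <-]] /=; rewrite ST => ->; rewrite linear0.
  + apply/seteqP; split=> // u _; exists (S (T u)); first by exists (T u).
    by exists (u - S (T u)); [rewrite /= linearB/= ST subrr|rewrite addrC subrK].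
- exists S; split=> //; exists T; split=> //.
  exact: continuous_subspaceT.
- exists (S \o T); split=> // _ v [x _ <-] /= Tv.
  by rewrite linearD/= ST Tv addr0.
Qed.

(** ** Coordinates by forward substitution *)
Section triangular_solution.
Variables (nu : nat -> fsmeasure R Z) (f : nat -> Z -> R).

(** What remains of [h] after its first [j] components along the [f i] have been
    removed. *)
Fixpoint residual (j : nat) (h : Z -> R) : Z -> R :=
  if j is i.+1 then
    fun z => residual i h z - integral_fs (nu i) (residual i h) * f i z
  else h.

Definition coordinate (j : nat) (h : Z -> R) : R :=
  integral_fs (nu j) (residual j h).

Lemma residualE j h z :
  residual j h z = h z - \sum_(i < j) coordinate i h * f i z.
Proof.
elim: j => [|j IH]; first by rewrite big_ord0 subr0.
by rewrite /= IH big_ord_recr/= opprD addrA.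
Qed.

Lemma coordinateE j h : coordinate j h =
  integral_fs (nu j) h - \sum_(i < j) coordinate i h * integral_fs (nu j) (f i).
Proof.
rewrite /coordinate (eq_integral_fs (g := fun z => h z - \sum_(i < j) coordinate i h * f i z)).
  rewrite integral_fsB integral_fs_sum; congr (_ - _).
  by apply: eq_bigr => i _; rewrite integral_fsZ.
by move=> z _; exact: residualE.
Qed.

Lemma residual_linear j a g h z :
  residual j (fun z => a * g z + h z) z = a * residual j g z + residual j h z.
Proof.
elim: j z => [//|j IH] z /=; rewrite IH.
rewrite (eq_integral_fs (g := fun z => a * residual j g z + residual j h z)) => [|x _//].
by rewrite integral_fsD integral_fsZ; ring.
Qed.

Lemma coordinate_linear j a g h :
  coordinate j (fun z => a * g z + h z) = a * coordinate j g + coordinate j h.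
Proof.
rewrite /coordinate -integral_fsZ -integral_fsD; apply: eq_integral_fs => z _.
exact: residual_linear.
Qed.

Lemma coordinate_continuous j : continuous (fun u => coordinate j (ev u)).
Proof.
have cres i z : continuous (fun u => residual i (ev u) z).
  elim: i z => [|i IH] z; first exact: ev_at_continuous.
  apply: continuous_sub; first exact: IH.
  apply: continuous_mul; last exact: continuous_const.
  by apply: continuous_sum => x; exact: continuous_scale.
by apply: continuous_sum => x; exact: continuous_scale.
Qed.

(** By [coordinateE] and induction, the coordinates are bounded by twice the bound on
    the integrals of [h], because each row sum is at most 1/2; since the row sums also
    tend to 0, the coordinates differ from these integrals by a null sequence. *)
Lemma coordinate_cvg0 h :
  (forall i j, (i < j)%N -> `|integral_fs (nu j) (f i)| <= j.+1%:R^-1 ^+ 2) ->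
  integral_fs (nu j) h @[j --> \oo] --> (0 : R) ->
  coordinate j h @[j --> \oo] --> (0 : R).
Proof.
move=> small h0.
have [M M0 hM] : exists2 M, 0 <= M & forall j, `|integral_fs (nu j) h| <= M.
  have : cvg (integral_fs (nu j) h @[j --> \oo]) by apply/cvg_ex; exists 0.
  move=> /cvg_seq_bounded[M [_ MP]]; exists (`|M| + 1); first by rewrite addr_ge0.
  move=> j; apply: (MP (`|M| + 1)) => //.
  by apply: le_lt_trans (ler_norm _) _; rewrite ltrDl.
have step j : (forall i, (i < j)%N -> `|coordinate i h| <= 2 * M) ->
    `|coordinate j h - integral_fs (nu j) h| <= 2 * M * j%:R * j.+1%:R^-1 ^+ 2.
  move=> IH; rewrite coordinateE addrAC subrr sub0r normrN.
  apply: le_trans (ler_norm_sum _ _ _) _.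
  have -> : 2 * M * j%:R * j.+1%:R^-1 ^+ 2 = \sum_(i < j) 2 * M * j.+1%:R^-1 ^+ 2.
    by rewrite sumr_const card_ord -[RHS]mulr_natr mulrAC.
  by apply: ler_sum => i _; rewrite normrM ler_pM//; [exact: IH|exact: small].
have jj j : j%:R * j.+1%:R^-1 ^+ 2 <= j.+1%:R^-1 :> R.
  rewrite expr2 mulrA -[leRHS]mul1r ler_wpM2r ?invr_ge0//.
  by rewrite ler_pdivrMr// mul1r ler_nat.
have jj2 j : j%:R * j.+1%:R^-1 ^+ 2 <= 1 / 2 :> R.
  case: j => [|j]; first by rewrite mul0r.
  apply: le_trans (jj _) _; rewrite div1r lef_pV2 ?posrE// ler_nat//.
have bound j : `|coordinate j h| <= 2 * M.
  elim/ltn_ind: j => j /step sj.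
  rewrite -[coordinate j h](subrK (integral_fs (nu j) h)).
  apply: le_trans (ler_normD _ _) _; rewrite mulr_natl mulr2n.
  apply: lerD => //; apply: le_trans sj _.
  have := ler_wpM2l M0 (jj2 j); rewrite -[2 * M * _ * _]mulrA -[2 * M * _]mulrA.
  by move: (M * _) => t; lra.
rewrite (_ : (fun j => coordinate j h) = (fun j => (coordinate j h -
  integral_fs (nu j) h) + integral_fs (nu j) h)); last first.
  by apply/funext => j; rewrite subrK.
suff d0 : coordinate j h - integral_fs (nu j) h @[j --> \oo] --> (0 : R).
  by have := cvgD d0 h0; rewrite addr0; apply.
apply/cvgr0Pnorm_le => e e0.
have /cvgr0Pnorm_le/(_ e e0) : 2 * M * harmonic j @[j --> \oo] --> (0 : R).
  by have := cvgM (cvg_cst (2 * M)) (@cvg_harmonic R); rewrite mulr0; apply.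
apply: filterS => j /= he; apply: le_trans (step j (fun i _ => bound i)) _.
apply: le_trans he; rewrite ger0_norm ?mulr_ge0 ?invr_ge0//.
by rewrite -mulrA ler_wpM2l// mulr_ge0.
Qed.

End triangular_solution.

(** The coordinates form a map [T] to the null sequences. At each point at most one
    [f j] is nonzero, so the sum of the [x j * f j] depends at each point on one
    coordinate of [x], and it is a uniform limit of its partial sums because [x] is
    null: this is the right inverse [S]. *)
Lemma complemented_copy_of_JN_sequence (mu : nat -> fsmeasure R Z) :
  JN_sequence mu -> contains_complemented_copy E (c0p R).
Proof.
move=> /(biorthogonal_system sepZ)[nu [f [nu0 [cf6 fdisj f0 int_f small]]]].
have cf j : continuous (f j) by have [] := cf6 j.
have f6 j z : `|f j z| <= 6 by have [] := cf6 j.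
have /choice[T TP] : forall u, exists x : c0p R,
    \val x = (fun j => coordinate nu f j (ev u)).
  move=> u; apply: c0p_mk; apply: coordinate_cvg0 => //.
  exact: nu0 (ev_continuous evE (u:=u)).
have Tlin : linear T.
  move=> a u v; apply: val_inj; apply/funext => j.
  rewrite TP -[RHS]/(a * \val (T u) j + \val (T v) j) !TP -coordinate_linear.
  by congr coordinate; apply/funext => z; exact: ev_linear.
have cT : continuous T.
  apply: continuous_c0p => n; under eq_fun do rewrite TP.
  exact: coordinate_continuous.
(* [kap z] is the only index whose function may be nonzero at [z] *)
have /choice[kap kapP] : forall z, exists k, forall j, f j z != 0 -> j = k.
  move=> z; have [[k fk]|nf] := pselect (exists k, f k z != 0).
    by exists k => j fj; exact: fdisj fj fk.
  by exists 0%N => j fj; case: nf; exists j.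
pose c z := f (kap z) z.
have fc j z : f j z = if j == kap z then c z else 0.
  case: eqP => [->//|jk]; apply/eqP/negPn/negP => fj.
  exact: jk (kapP _ _ fj).
pose s (x : c0p R) z : R := \val x (kap z) * c z.
have cs x : continuous (s x).
  apply: continuous_of_uniform_approximation => e e0.
  have /cvgr0Pnorm_le/(_ (e / 6) (divr_gt0 e0 (ltr0Sn _ _)))[N _ NP] := c0p_cvg0 x.
  exists (fun z => \sum_(i < N) \val x i * f i z).
    by apply: continuous_sum => i; exact: continuous_scale.
  move=> z; have [kN|Nk] := ltnP (kap z) N.
    rewrite (bigD1 (Ordinal kN))//= big1 ?addr0 ?subrr ?normr0 ?ltW// => i ik.
    by rewrite fc ifN ?mulr0.
  rewrite big1 => [|i _]; last first.
    by rewrite fc ifN ?mulr0// neq_ltn (leq_trans (ltn_ord i)).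
  rewrite subr0 normrM -[e](@divfK _ 6)//.
  by apply: ler_pM => //; [exact: NP|exact: f6].
have /choice[S SP] : forall x, exists u, ev u = s x by move=> x; exact: ev_onto.
have Slin : linear S.
  move=> a x y; apply: (ev_inj evE); apply/funext => z.
  rewrite (ev_linear evE) !SP /s mulrA -mulrDl.
  by rewrite -[\val (a *: x + y) (kap z)]/(a * \val x (kap z) + \val y (kap z)).
have cS : continuous S.
  move=> x; have FS : Filter (S y @[y --> x]) by apply: fmap_filter; exact: nbhs_filter.
  apply/(ev_cvg evE _ FS) => z; suff : ev (S y) z @[y --> x] --> ev (S x) z by [].
  rewrite SP; under eq_fun do rewrite SP.
  apply: (@continuous_mul _ _ (fun x : c0p R => \val x (kap z)) (fun=> c z)).
    exact: c0p_coord_continuous.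
  exact: continuous_const.
have int_s x j : integral_fs (nu j)
    (fun z => if (j <= kap z)%N then s x z else 0) = \val x j.
  rewrite -[RHS]mulr1 -(int_f j) -integral_fsZ; apply: eq_integral_fs => z zj.
  rewrite fc; have [->|jk] := eqVneq j (kap z); first by rewrite leqnn.
  rewrite mulr0; case: ifP => // jlek; rewrite /s /c (f0 j)// ?mulr0//.
  by rewrite ltn_neqAle jk.
have resS x j z : residual nu f j (s x) z = if (j <= kap z)%N then s x z else 0.
  elim: j z => [//|j IH] z /=; rewrite IH.
  rewrite (eq_integral_fs (g := fun z => if (j <= kap z)%N then s x z else 0)) => [|y _//].
  rewrite int_s fc; have [->|jk] := eqVneq j (kap z).
    by rewrite leqnn ltnn subrr.
  by rewrite mulr0 subr0 ltn_neqAle jk.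
have ST x : T (S x) = x.
  apply: val_inj; apply/funext => j; rewrite TP SP -[RHS]int_s.
  by apply: eq_integral_fs => z _; exact: resS.
pose T' : {linear E -> c0p R} := HB.pack T (GRing.isLinear.Build R E (c0p R) *:%R T Tlin).
pose S' : {linear c0p R -> E} := HB.pack S (GRing.isLinear.Build R (c0p R) E *:%R S Slin).
exact: (@complemented_copy_of_section T' S').
Qed.

End complemented_copies.
(** * Josefson-Nissenzweig sequences on lines of a product *)
Section pushforward.
Context {R : realType}.

Lemma JN_sequence_pushforward (X Z : topologicalType) (p : X -> Z) (r : Z -> X)
    (mu : nat -> fsmeasure R X) :
  cancel p r -> continuous p -> JN_sequence mu ->
  exists nu : nat -> fsmeasure R Z, JN_sequence nu.
Proof.
move=> pr cp [mu0 mu1]; have pinj := can_inj pr.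
have up n : uniq (map p (supp (mu n))) by rewrite map_inj_uniq// supp_uniq.
pose nu n := FSMeasure (fun z => wt (mu n) (r z)) (up n).
exists nu; split.
  move=> h ch; have hp : continuous (h \o p).
    by move=> x; exact: (cvg_comp _ _ (cp x) (ch (p x))).
  suff -> : (fun n => integral_fs (nu n) h) = (fun n => integral_fs (mu n) (h \o p)).
    exact: mu0.
  apply/funext => n; rewrite /integral_fs big_map.
  by apply: eq_bigr => x _; rewrite /= pr.
move=> n; rewrite -(mu1 n) /mass big_map.
by apply: eq_bigr => x _; rewrite /= pr.
Qed.

Lemma weighted_pushforward (Z Y : eqType) (m : fsmeasure R Z) (c : Z -> R) (q : Z -> Y) :
  exists nu : fsmeasure R Y, forall h,
    integral_fs nu h = integral_fs m (fun z => c z * h (q z)).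
Proof.
exists (FSMeasure (fun y => \sum_(z <- supp m | q z == y) wt m z * c z)
  (undup_uniq (map q (supp m)))) => h.
rewrite /integral_fs/=; under eq_bigr do rewrite big_distrl/= big_mkcond/=.
rewrite exchange_big/= big_seq [RHS]big_seq; apply: eq_bigr => z zm.
rewrite (bigD1_seq (q z))/= ?undup_uniq//; last by rewrite mem_undup map_f.
rewrite eqxx big1 ?addr0 ?mulrA// => y /negPf yq.
by rewrite eq_sym yq.
Qed.

End pushforward.

Section slices.
Context {R : realType} {Z X Y : topologicalType}.
Variables (p : Z -> X) (q : Z -> Y) (pair_pq : X -> Y -> Z).
Hypothesis pqK : forall z, pair_pq (p z) (q z) = z.
Hypothesis continuous_pq : forall (f : X -> R) (g : Y -> R),
  continuous f -> continuous g -> continuous (fun z => f (p z) * g (q z)).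
Hypothesis sepX : separates_points R X.

(** Weighting by a function [phi] of [p] that isolates [a] in [A] and projecting along
    [q] gives a weakly null sequence on [Y], whose norms must tend to 0. Outside [B] its
    weights are those of [mu n] on the line [p = a], as the other charged points there
    have [p] in [A]. The roles of [p] and [q] can be exchanged. *)
Lemma slice_mass_cvg0 (mu : nat -> fsmeasure R Z) (A : seq X) (B : seq Y) (a : X) :
  weak_null mu ->
  (forall n, {in supp (mu n), forall z, wt (mu n) z != 0 -> p z \in A \/ q z \in B}) ->
  ~ (exists nu : nat -> fsmeasure R Y, JN_sequence nu) ->
  mass (mu n) [pred z | (p z == a) && (q z \notin B)] @[n --> \oo] --> (0 : R).
Proof.
move=> mu0 AB nJN.
have [|phi [cphi phia phiA]] := @bump _ _ sepX [seq x <- A | x != a] a.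
  by rewrite mem_filter eqxx.
have /choice[nu nuP] := fun n => weighted_pushforward (mu n) (fun z => phi (p z)) q.
have nu0 : weak_null nu.
  move=> h ch; under eq_fun do rewrite nuP.
  by apply: mu0; exact: continuous_pq.
have mass0 : mass (nu n) predT @[n --> \oo] --> (0 : R).
  by apply: contrapT => /(JN_sequence_of_norm nu0).
apply: cvg0_le mass0 => n; rewrite mass_ge0/=.
pose h y := if y \in B then 0 else Num.sg (wt (mu n) (pair_pq a y)).
have -> : mass (mu n) [pred z | (p z == a) && (q z \notin B)] = integral_fs (nu n) h.
  rewrite nuP /mass big_mkcond /integral_fs; apply: eq_big_seq => z zn /=.
  have [->|wz] := eqVneq (wt (mu n) z) 0; first by rewrite normr0 mul0r if_same.
  rewrite /h; case: (boolP (q z \in B)) => [qB|qB]; first by rewrite andbF !mulr0.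
  rewrite andbT; case: eqVneq => [pa|pa].
    by rewrite pa phia mul1r -pa pqK mulrC -normrEsg.
  rewrite phiA ?mul0r ?mulr0// mem_filter pa.
  by have [//|] := AB n z zn wz; rewrite (negPf qB).
apply: le_trans (ler_norm _) _; rewrite -[leRHS]mul1r; apply: normr_integral_fs => y _ _.
rewrite /h; case: ifP => _; first by rewrite normr0.
by rewrite normr_sg; case: (_ != _).
Qed.

End slices.

(** * The cross topology and separately continuous functions *)

(** An alias, because the type of pairs already carries the product topology. *)
Definition cross (X Y : Type) : Type := (X * Y)%type.

Section cross_topology.
Context {X Y : topologicalType}.

HB.instance Definition _ := Choice.copy (cross X Y) (X * Y)%type.

Definition cross_open (U : set (cross X Y)) :=
  (forall x, open [set y | U (x, y)]) /\ (forall y, open [set x | U (x, y)]).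

Let cross_openT : cross_open setT.
Proof. by split=> ?; exact: openT. Qed.

Let cross_openI : setI_closed cross_open.
Proof.
move=> U V [U1 U2] [V1 V2].
by split=> t; [exact: openI (U1 t) (V1 t)|exact: openI (U2 t) (V2 t)].
Qed.

Let cross_open_bigU (I : Type) (U : I -> set (cross X Y)) :
  (forall i, cross_open (U i)) -> cross_open (\bigcup_i U i).
Proof.
move=> oU; split=> t.
  by apply: (@bigcup_open _ _ setT (fun i => [set y | U i (t, y)])) => i _; have [] := oU i.
by apply: (@bigcup_open _ _ setT (fun i => [set x | U i (x, t)])) => i _; have [] := oU i.
Qed.

HB.instance Definition _ := isOpenTopological.Build (cross X Y)
  cross_openT cross_openI cross_open_bigU.

Lemma cross_continuousP (T : topologicalType) (h : cross X Y -> T) :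
  continuous h <-> (forall x, continuous (fun y => h (x, y))) /\
                   (forall y, continuous (fun x => h (x, y))).
Proof.
split=> [ch|[h1 h2] z A].
  split=> [x y A /ch [B [[B1 _] Bz BA]]|y x A /ch [B [[_ B2] Bz BA]]].
    by rewrite nbhsE; exists [set y | B (x, y)]; [split; [exact: B1|]|move=> t /BA].
  by rewrite nbhsE; exists [set x | B (x, y)]; [split; [exact: B2|]|move=> t /BA].
rewrite nbhsE => -[B [oB Bz] BA]; exists (h @^-1` B); split=> // [|t /BA //].
split=> [x|y].
  by have /continuousP/(_ _ oB) := h1 x.
by have /continuousP/(_ _ oB) := h2 y.
Qed.

End cross_topology.

Section JN_sequences_on_cross.
Context {R : realType} {X Y : topologicalType}.
Hypothesis sepX : separates_points R X.
Hypothesis sepY : separates_points R Y.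

Lemma continuous_cross_mul (f : X -> R) (g : Y -> R) :
  continuous f -> continuous g -> continuous (fun z : cross X Y => f z.1 * g z.2).
Proof.
move=> cf cg; apply/cross_continuousP; split=> [x|y].
  exact: (continuous_mul (@continuous_const _ _ (f x)) cg).
exact: (continuous_mul cf (@continuous_const _ _ (g y))).
Qed.

Lemma cross_separates_points : separates_points R (cross X Y).
Proof.
move=> [x y] [x' y'] xy; have [xx|xx] := pselect (x = x').
  have [|h ch hy] := sepY (x := y) (y := y'); first by move=> yy; apply: xy; rewrite xx yy.
  exists (fun z : cross X Y => h z.2) => //.
  by apply/cross_continuousP; split=> t; [exact: ch|exact: (@continuous_const _ _ (h t))].
have [h ch hx] := sepX xx.
exists (fun z : cross X Y => h z.1) => //.
by apply/cross_continuousP; split=> t; [exact: (@continuous_const _ _ (h t))|exact: ch].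
Qed.

Lemma JN_sequence_crossl (y : Y) (mu : nat -> fsmeasure R X) : JN_sequence mu ->
  exists nu : nat -> fsmeasure R (cross X Y), JN_sequence nu.
Proof.
apply: (@JN_sequence_pushforward _ _ _ (fun x => (x, y) : cross X Y) fst) => //.
by have /cross_continuousP[_] := (fun z A h => h) : continuous (@id (cross X Y)).
Qed.

Lemma JN_sequence_crossr (x : X) (mu : nat -> fsmeasure R Y) : JN_sequence mu ->
  exists nu : nat -> fsmeasure R (cross X Y), JN_sequence nu.
Proof.
apply: (@JN_sequence_pushforward _ _ _ (fun y => (x, y) : cross X Y) snd) => //.
by have /cross_continuousP[] := (fun z A h => h) : continuous (@id (cross X Y)).
Qed.

(** Along a subsequence there are functions [g i] of the first variable and [g' i] of the
    second, each family with disjoint supports, both equal to 1 at the [i]-th point.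
    The sum of the [i * g i * g' i] is separately continuous, since on each line it has
    at most one nonzero term. *)
Lemma unbounded_on_matching (z : nat -> cross X Y) :
  (forall i j, (i < j)%N -> (z j).1 != (z i).1 /\ (z j).2 != (z i).2) ->
  exists2 h : cross X Y -> R, continuous h &
    forall M, exists i, M < `|h (z i)|.
Proof.
move=> zinj.
have [k [g [kS cg gdisj gk]]] := @disjoint_bumps R X sepX (fun j => (z j).1)
  (fun i j ij => (zinj i j ij).1).
have kmono := strictly_increasing_mono kS.
have [l [g' [lS cg' gdisj' gl]]] := @disjoint_bumps R Y sepY (fun j => (z (k j)).2)
  (fun i j ij => (zinj _ _ (kmono i j ij)).2).
have linj := strictly_increasing_inj lS.
have index (T : Type) (f : nat -> T -> R) :
    (forall i j t, f i t != 0 -> f j t != 0 -> i = j) ->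
    exists kap : T -> nat, forall i t, i != kap t -> f i t = 0.
  move=> fdisj; have /choice[kap kapP] : forall t, exists i, forall j, j != i -> f j t = 0.
    move=> t; have [[i fi]|nf] := pselect (exists i, f i t != 0).
      exists i => j /eqP ji; apply/eqP/negPn/negP => fj; apply: ji; exact: fdisj fj fi.
    by exists 0%N => j _; apply/eqP/negPn/negP => fj; apply: nf; exists j.
  by exists kap => i t; exact: kapP.
have [kap kapP] := index _ (fun j => g (l j)) (fun i j t gi gj => linj i j (gdisj _ _ t gi gj)).
have [kap' kapP'] := index _ g' gdisj'.
pose h (t : cross X Y) := (kap t.1)%:R * (g (l (kap t.1)) t.1 * g' (kap t.1) t.2).
(* the symmetric expression of the same sum, used for sections in the other variable *)
have h' t : h t = (kap' t.2)%:R * (g' (kap' t.2) t.2 * g (l (kap' t.2)) t.1).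
  rewrite /h; have [->|kk] := eqVneq (kap t.1) (kap' t.2); first by congr (_ * _); rewrite mulrC.
  by rewrite (kapP' _ _ kk) (kapP (kap' t.2)) ?mulr0// eq_sym.
exists h.
  apply/cross_continuousP; split=> [x|y].
    rewrite (_ : (fun y => h (x, y)) = fun y =>
      (kap x)%:R * (g (l (kap x)) x * g' (kap x) y))//.
    by apply: continuous_scale; exact: continuous_scale.
  rewrite (_ : (fun x => h (x, y)) = fun x =>
    (kap' y)%:R * (g' (kap' y) y * g (l (kap' y)) x)); last by apply/funext => x; exact: h'.
  by apply: continuous_scale; exact: continuous_scale.
move=> M; pose i := (Num.truncn M).+1; exists (k (l i)).
have ki : kap (z (k (l i))).1 = i.
  apply/eqP/negPn/negP; rewrite eq_sym => /kapP /eqP.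
  by rewrite gk oner_eq0.
by rewrite /h ki gk gl !mulr1 normr_nat; exact: truncnS_gt.
Qed.

(** Otherwise charged points can be chosen one after the other, each sharing no line with
    the previous ones, and [unbounded_on_matching] contradicts the boundedness of
    continuous functions on supports. *)
Lemma supports_on_finitely_many_lines (mu : nat -> fsmeasure R (cross X Y)) :
  weak_null mu -> exists (A : seq X) (B : seq Y), forall n,
    {in supp (mu n), forall z, wt (mu n) z != 0 -> z.1 \in A \/ z.2 \in B}.
Proof.
move=> mu0; apply: contrapT => H.
have /choice[pick pickP] : forall s : seq (cross X Y), exists z : cross X Y,
    (exists n, z \in supp (mu n) /\ wt (mu n) z != 0) /\
    {in s, forall t, z.1 != t.1 /\ z.2 != t.2}.
  move=> s; apply: contrapT => Hs; apply: H.
  exists (map fst s), (map snd s) => n z zn wz; apply: contrapT => /not_orP[z1 z2].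
  apply: Hs; exists z; split; first by exists n.
  move=> t ts; split; apply/eqP => zt.
  - by apply: z1; rewrite zt; apply: (map_f fst).
  - by apply: z2; rewrite zt; apply: (map_f snd).
pose fix st j : seq (cross X Y) := if j is i.+1 then pick (st i) :: st i else [::].
pose z j := pick (st j).
have zst i j : (i < j)%N -> z i \in st j.
  elim: j => [//|j IH]; rewrite ltnS leq_eqVlt inE => /predU1P[->|/IH ->].
    by rewrite eqxx.
  by rewrite orbT.
have [h ch hz] := unbounded_on_matching (fun i j ij => (pickP (st j)).2 _ (zst i j ij)).
have [M MP] := weak_null_bounded_support cross_separates_points mu0 ch.
have [i] := hz M; have [[n [zn wz]] _] := pickP (st i).
by apply/negP; rewrite -leNgt; exact: MP wz.
Qed.

(** If neither factor had such a sequence, the mass on each line, off the finitely many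
    crossings [F] of the lines, would tend to 0 by [slice_mass_cvg0], whereas at least
    1/3 of the mass leaves [F]. *)
Lemma JN_sequence_of_cross (mu : nat -> fsmeasure R (cross X Y)) : JN_sequence mu ->
  (exists nu : nat -> fsmeasure R X, JN_sequence nu) \/
  (exists nu : nat -> fsmeasure R Y, JN_sequence nu).
Proof.
move=> JNmu; have [mu0 mu1] := JNmu; apply: contrapT => /not_orP[nX nY].
have [A [B AB]] := supports_on_finitely_many_lines mu0.
have sliceX a := @slice_mass_cvg0 R (cross X Y) X Y fst snd (fun x y => (x, y))
  (fun z => esym (surjective_pairing z)) continuous_cross_mul sepX mu A B a mu0 AB nY.
have sliceY b : mass (mu n) [pred z | (z.2 == b) && (z.1 \notin A)] @[n --> \oo] --> (0 : R).
  apply: (@slice_mass_cvg0 R (cross X Y) Y X snd fst (fun y x => (x, y))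
    (fun z => esym (surjective_pairing z)) _ sepY mu B A b mu0) => //.
  - move=> f g cf cg; rewrite (_ : (fun _ => _) = (fun z : cross X Y => g z.1 * f z.2)).
      exact: continuous_cross_mul.
    by apply/funext => z; rewrite mulrC.
  - by move=> n z zn wz; apply/or_comm; exact: AB wz.
pose F : seq (cross X Y) := [seq (a, b) | a <- A, b <- B].
have lines0 : \sum_(a <- undup A) mass (mu n) [pred z | (z.1 == a) && (z.2 \notin B)] +
    \sum_(b <- undup B) mass (mu n) [pred z | (z.2 == b) && (z.1 \notin A)]
    @[n --> \oo] --> (0 : R).
  by have := cvgD (@cvg_sum0 R _ (undup A) _ sliceX) (@cvg_sum0 R _ (undup B) _ sliceY); rewrite addr0; apply.
have [N _ NP] := mass_escapes cross_separates_points F JNmu.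
have /cvgr0Pnorm_lt/(_ (1 / 3) (divr_gt0 ltr01 (ltr0Sn _ _)))[N' _ NP'] := lines0.
have := NP (maxn N N') (leq_maxl _ _); have := NP' (maxn N N') (leq_maxr _ _) => /=.
move: (maxn N N') => n /(le_lt_trans (ler_norm _)) lt13 /(lt_le_trans lt13).
apply/negP; rewrite -leNgt /mass.
under eq_bigr do rewrite big_mkcond/=.
under [X in _ + X]eq_bigr do rewrite big_mkcond/=.
rewrite exchange_big/= [X in _ + X]exchange_big/= -big_split/= big_mkcond/=.
rewrite big_seq [leRHS]big_seq; apply: ler_sum => z zn.
have ge0 (s : seq X) (P : X -> bool) : 0 <= \sum_(i <- s) (if P i then `|wt (mu n) z| else 0).
  by apply: sumr_ge0 => i _; case: ifP.
have ge0' (s : seq Y) (P : Y -> bool) : 0 <= \sum_(i <- s) (if P i then `|wt (mu n) z| else 0).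
  by apply: sumr_ge0 => i _; case: ifP.
case: ifPn => [zF|_]; last by rewrite addr_ge0.
have [wz|wz] := eqVneq (wt (mu n) z) 0; first by rewrite {1}wz normr0 addr_ge0.
have [zA|zB] := AB n z zn wz.
  have zB : z.2 \notin B.
    by apply: contra zF => zB; rewrite [z]surjective_pairing; apply: allpairs_f.
  rewrite (bigD1_seq z.1)/= ?mem_undup ?undup_uniq// eqxx zB -addrA lerDl addr_ge0//.
  by apply: sumr_ge0 => i _; case: ifP.
have zA : z.1 \notin A.
  by apply: contra zF => zA; rewrite [z]surjective_pairing; apply: allpairs_f.
rewrite [X in _ + X](bigD1_seq z.2)/= ?mem_undup ?undup_uniq// eqxx zA addrCA lerDl addr_ge0//.
by apply: sumr_ge0 => i _; case: ifP.
Qed.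

End JN_sequences_on_cross.
(** * The spaces C_p(X) and C_p(X, C_p(Y)) *)
Section models.
Context {R : realType}.

Lemma tychonoff_separates_points (X : topologicalType) :
  tychonoff_space X -> separates_points R X.
Proof.
move=> /(tychonoff_spaceP R)[sep hX] x y xy.
have [|z|f [cf _ fx fy]] := sep x [set y].
- exact: (accessible_closed_set1 (hausdorff_accessible hX)).
- exact.
by exists f => //; rewrite fx (fy y erefl); apply/eqP; rewrite eq_sym oner_eq0.
Qed.

Lemma Cp_mk (X : topologicalType) (E : tvsType R) (h : X -> E) :
  continuous h -> exists u : Cp X E, \val u = h.
Proof.
by move=> ch; exists (Sub h (mem_set ch : h \in @Cp_pred R X E)); rewrite SubK.
Qed.

Lemma Cp_val_linear (X : topologicalType) (E : tvsType R) a (u v : Cp X E) x :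
  \val (a *: u + v) x = a *: \val u x + \val v x.
Proof. by rewrite linearP. Qed.

Lemma models_Cp_scalar (X : topologicalType) :
  models_Cp (fun u : Cp X R^o => \val u : X -> R).
Proof.
split=> //.
- by move=> u v /val_inj.
- by move=> u; exact: cts_fun.
- by move=> h ch; exact: (@Cp_mk X R^o).
- by move=> F u FF; exact: Cp_cvgP.
Qed.

(** Stated for any model [E] of C_p(Y) rather than for C_p(Y) itself, so that the
    structures on the space of values stay abstract in the proof. *)
Lemma models_Cp_cross (X Y : topologicalType) (E : tvsType R) (ev : E -> Y -> R) :
  models_Cp ev ->
  models_Cp (fun (u : Cp X E) (z : cross X Y) => ev (\val u z.1) z.2).
Proof.
move=> evE; have cval (u : Cp X E) : continuous (\val u) by exact: cts_fun.
split.
- by move=> a u v z; rewrite Cp_val_linear (ev_linear evE).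
- move=> u v uv; apply: val_inj; apply/funext => x; apply: (ev_inj evE).
  by apply/funext => y; have := congr1 (@^~ (x, y)) uv.
- move=> u; apply: (cross_continuousP _).2; split=> [x|y x].
    exact: (@ev_continuous _ _ _ _ evE (\val u x)).
  exact: (cvg_comp _ _ (cval u x) (@ev_at_continuous _ _ _ _ evE y (\val u x))).
- move=> h /cross_continuousP[h1 h2].
  have /choice[g gE] := fun x => ev_onto evE (h1 x).
  have cg : continuous g.
    move=> x; have Fg : Filter (g t @[t --> x]) by apply: fmap_filter; exact: nbhs_filter.
    apply/(ev_cvg evE _ Fg) => y.
    suff : ev (g t) y @[t --> x] --> ev (g x) y by [].
    by rewrite gE; under eq_fun do rewrite gE; exact: h2.
  have [u ug] := Cp_mk cg.
  by exists u; apply/funext => -[x y]; rewrite ug gE.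
- move=> F u FF; split=> [/Cp_cvgP Fu [x y]|Fu].
    exact: (cvg_comp _ _ (Fu x) (@ev_at_continuous _ _ _ _ evE y (\val u x))).
  apply/Cp_cvgP => x; have Fx : Filter (\val v x @[v --> F]) by exact: fmap_filter.
  by apply/(ev_cvg evE _ Fx) => y; exact: (Fu (x, y)).
Qed.

End models.

Theorem theorem5p2 (R : realType) (X Y : topologicalType)
    (X_tychonoff : tychonoff_space X) (Y_tychonoff : tychonoff_space Y)
    (X_infinite : infinite_set [set: X]) (Y_infinite : infinite_set [set: Y]) :
  [<-> JNP (Cp X (Cp Y R^o));
       contains_complemented_copy (Cp X (Cp Y R^o)) (c0p R);
       continuous_linear_surjection_onto (Cp X (Cp Y R^o)) (c0p R);
       contains_complemented_copy (Cp X R^o) (c0p R) \/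
       contains_complemented_copy (Cp Y R^o) (c0p R);
       continuous_linear_surjection_onto (Cp X R^o) (c0p R) \/
       continuous_linear_surjection_onto (Cp Y R^o) (c0p R);
       JNP (Cp X R^o) \/ JNP (Cp Y R^o)].
Proof.
have sepX := tychonoff_separates_points (R := R) X_tychonoff.
have sepY := tychonoff_separates_points (R := R) Y_tychonoff.
have sepXY := cross_separates_points sepX sepY.
have mX := models_Cp_scalar (R := R) X; have mY := models_Cp_scalar (R := R) Y.
have mXY := models_Cp_cross X mY.
tfae.
- move=> /(JN_sequence_of_JNP mXY sepXY)[mu].
  exact: (complemented_copy_of_JN_sequence mXY sepXY).
- exact: surjection_of_complemented_copy.
- move=> /(JN_sequence_of_surjection mXY sepXY)[mu] /(JN_sequence_of_cross sepX sepY).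
  move=> [[nu]|[nu]].
    by move=> H; left; exact: (complemented_copy_of_JN_sequence mX sepX) H.
  by move=> H; right; exact: (complemented_copy_of_JN_sequence mY sepY) H.
- by move=> []; [left|right]; exact: surjection_of_complemented_copy.
- move=> [/(JN_sequence_of_surjection mX sepX)|/(JN_sequence_of_surjection mY sepY)] [mu].
    by move=> H; left; exact: (JNP_of_JN_sequence mX sepX) H.
  by move=> H; right; exact: (JNP_of_JN_sequence mY sepY) H.
- have [y _] := infinite_setN0 Y_infinite; have [x _] := infinite_setN0 X_infinite.
  move=> [/(JN_sequence_of_JNP mX sepX)|/(JN_sequence_of_JNP mY sepY)] [mu].
    move=> /(JN_sequence_crossl y)[nu]; exact: (JNP_of_JN_sequence mXY sepXY).
  move=> /(JN_sequence_crossr x)[nu]; exact: (JNP_of_JN_sequence mXY sepXY).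
Qed.
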